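(* Let $(\Delta^t)_{t\in\mathbb{R}}$ be the filtration of a monotonic $f:\Delta\to\mathbb{R}$; fix $i\in[n]$, $q\ge0$, $s\le t$, and a multidegree $\alpha=(c;b)$ with $b\in\mathbb{Z}^{[n]\setminus\{i\}}$. Write $\sigma=\operatorname{supp}_-(b)$ and $d=q-|\sigma|-1$. If $\operatorname{supp}_+(b)\neq\varnothing$ then $\lambda^{q,s\to t}_{i,\alpha}=0$. If $\operatorname{supp}_+(b)=\varnothing$, then $$\lambda^{q,s\to t}_{i,\alpha}=\begin{cases}\operatorname{rank}\Big(\widetilde H^{d}\big(\operatorname{lk}_{\Delta^t}(\sigma)\cap\operatorname{del}_{\Delta^t}(i);k\big)\to\widetilde H^{d}\big(\operatorname{lk}_{\Delta^s}(\sigma)\cap\operatorname{del}_{\Delta^s}(i);k\big)\Big),& c=0,\\[4pt] \operatorname{rank}\Big(\widetilde H^{d}\big(\operatorname{lk}_{\Delta^t}(\sigma\cup\{i\});k\big)\to\widetilde H^{d}\big(\operatorname{lk}_{\Delta^s}(\sigma\cup\{i\});k\big)\Big),& c\ge1,\end{cases}$$ where each map is the restriction in reduced cohomology induced by the inclusion of the corresponding subcomplex of $\Delta^s$ into that of $\Delta^t$. Equivalently, each of these ranks equals the rank of the map induced by the same inclusion on reduced homology in degree $d$, running in the filtration direction from the complex at level $s$ to the complex at level $t$.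
   Context: $k$ is a field, $[n]=\{1,\dots,n\}$, $S=k[x_1,\dots,x_n]$ with the $\mathbb{Z}^n$-grading $\deg x_j=\mathbf e_j$. A simplicial complex on $[n]$ is a family of subsets of $[n]$ closed under passing to subsets; $\Delta$ is a simplicial complex on $[n]$ of which every singleton is a face. For any complex $\Gamma$ on $[n]$, $I_\Gamma\subseteq S$ is generated by the monomials $\prod_{j\in\tau}x_j$, $\tau\subseteq[n]$, $\tau\notin\Gamma$, and $k[\Gamma]=S/I_\Gamma$. A function $f:\Delta\to\mathbb{R}$ is monotonic if $f(\tau)\le f(\sigma)$ whenever $\tau\subseteq\sigma$; its filtration is $\Delta^t=\{\sigma\in\Delta:f(\sigma)\le t\}$ (a stage may miss some vertices, or be void; the void complex, having no faces, has $k[\Gamma]=0$). For $s\le t$ the inclusion $\Delta^s\subseteq\Delta^t$ gives a surjection $k[\Delta^t]\twoheadrightarrow k[\Delta^s]$, inducing a $\mathbb{Z}^n$-graded map $\theta^{t\to s}_{i,q}:H^q_{\mathfrak p_i}(k[\Delta^t])\to H^q_{\mathfrak p_i}(k[\Delta^s])$ on local cohomology with support in $\mathfrak p_i=(x_j:j\ne i)\subseteq S$. The persistent per-vertex local cohomology number is $\lambda^{q,s\to t}_{i,\alpha}=\operatorname{rank}\big(\theta^{t\to s}_{i,q}:H^q_{\mathfrak p_i}(k[\Delta^t])_\alpha\to H^q_{\mathfrak p_i}(k[\Delta^s])_\alpha\big)$. A multidegree $\alpha\in\mathbb{Z}^n$ is written $(c;b)$ with $c=\alpha_i$, $b=(\alpha_j)_{j\ne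 i}$; $\operatorname{supp}_+(b)=\{j:b_j>0\}$, $\operatorname{supp}_-(b)=\{j:b_j<0\}$. $\operatorname{lk}_\Gamma(\sigma)=\{\tau:\tau\cap\sigma=\varnothing,\ \tau\cup\sigma\in\Gamma\}$, which is the void complex when $\sigma\notin\Gamma$; $\operatorname{del}_\Gamma(i)=\{\tau\in\Gamma:i\notin\tau\}$. Reduced simplicial (co)homology has $\widetilde H^{-1}(\{\varnothing\};k)=k$, is zero for the void complex, and is zero in degrees $<-1$. *)

(* Defs.v *)
From HB Require Import structures.
From mathcomp Require Import all_boot all_order all_algebra.
From mathcomp Require Import generic_quotient ring_quotient.
From mathcomp Require Import boolp reals.
From mathcomp Require Import mpoly zify ring.

Set Implicit Arguments.
Unset Strict Implicit.
Unset Printing Implicit Defensive.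

Import Order.TTheory GRing.Theory Num.Theory.
Local Open Scope ring_scope.
Local Open Scope quotient_scope.

(* [W] is a linear subspace having a basis with [r] elements; [V] itself may
   be infinite-dimensional. *)
Definition has_dim (k : fieldType) (V : lmodType k) (W : V -> Prop) (r : nat) :
    Prop :=
  exists v : 'I_r -> V,
    [/\ forall a : 'I_r -> k, W (\sum_(l < r) a l *: v l),
        forall a : 'I_r -> k,
          \sum_(l < r) a l *: v l = 0 -> forall l, a l = 0
      & forall w, W w -> exists a : 'I_r -> k, w = \sum_(l < r) a l *: v l].

Definition image_of (U V : Type) (g : U -> V) (P : U -> Prop) : V -> Prop :=
  fun w => exists2 u, P u & w = g u.

(* The rank over [k] of the restriction of [g] to the subspace [P] is [r]. *)
Definition has_rank_on (k : fieldType) (U : Type) (V : lmodType k)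
    (g : U -> V) (P : U -> Prop) (r : nat) : Prop :=
  has_dim (image_of g P) r.

Section QuotientModule.
Variables (A : nzRingType) (V : lmodType A) (N : submodClosed V).

(* The library's [submodClosed] does not record closure under opposites, which
   [Quotient.quot] needs. *)
Definition submod_pred : {pred V} := fun v => v \in N.
Fact submod_pred_closed : zmod_closed submod_pred.
Proof.
split=> [|u v hu hv]; first exact: (rpred0 N).
by apply: (rpredD (S := N)) => //; rewrite -scaleN1r; apply: (rpredZ (s := N)).
Qed.
HB.instance Definition _ :=
  GRing.isZmodClosed.Build V submod_pred submod_pred_closed.
Definition submod_zmod : zmodClosed V := submod_pred.

Definition quotmod : Type := Quotient.quot submod_zmod.
HB.instance Definition _ := GRing.Zmodule.on quotmod.

Definition quotmod_pi (v : V) : quotmod := \pi_(Quotient.quot submod_zmod) v.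
Definition quotmod_repr (x : quotmod) : V := repr (x : Quotient.quot submod_zmod).

Lemma quotmod_reprK x : quotmod_pi (quotmod_repr x) = x.
Proof. exact: reprK. Qed.

Lemma quotmod_piE u v : (quotmod_pi u = quotmod_pi v) <-> (u - v \in N).
Proof.
rewrite -[_ \in N]/(u - v \in submod_zmod) Quotient.idealrBE.
by split=> [h|/eqP//]; apply/eqP.
Qed.

Lemma quotmod_piD u v : quotmod_pi (u + v) = quotmod_pi u + quotmod_pi v.
Proof. exact: raddfD. Qed.

Definition quotmod_scale (a : A) (x : quotmod) : quotmod :=
  quotmod_pi (a *: quotmod_repr x).

Lemma quotmod_scale_pi a v : quotmod_scale a (quotmod_pi v) = quotmod_pi (a *: v).
Proof.
apply/quotmod_piE; rewrite -scalerBr rpredZ //.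
by apply/quotmod_piE; rewrite quotmod_reprK.
Qed.

Fact quotmod_scaleA a b x :
  quotmod_scale a (quotmod_scale b x) = quotmod_scale (a * b) x.
Proof.
by rewrite -[x]quotmod_reprK !quotmod_scale_pi scalerA.
Qed.

Fact quotmod_scale1 : left_id 1 quotmod_scale.
Proof. by move=> x; rewrite -[x]quotmod_reprK quotmod_scale_pi scale1r. Qed.

Fact quotmod_scaleDr : right_distributive quotmod_scale +%R.
Proof.
move=> a x y; rewrite -[x]quotmod_reprK -[y]quotmod_reprK.
by rewrite -quotmod_piD !quotmod_scale_pi scalerDr quotmod_piD.
Qed.

Fact quotmod_scaleDl x : {morph quotmod_scale^~ x : a b / a + b}.
Proof.
by move=> a b; rewrite -[x]quotmod_reprK !quotmod_scale_pi scalerDl quotmod_piD.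
Qed.

HB.instance Definition _ := GRing.Zmodule_isLmodule.Build A quotmod
  quotmod_scaleA quotmod_scale1 quotmod_scaleDr quotmod_scaleDl.

End QuotientModule.

(* The map induced on quotients by [phi]; meaningful when [phi] is linear and
   sends [N] into [N']. *)
Definition quotmod_map (A : nzRingType) (V V' : lmodType A)
    (N : submodClosed V) (N' : submodClosed V') (phi : V -> V')
    (x : quotmod N) : quotmod N' :=
  quotmod_pi N' (phi (quotmod_repr x)).

Definition range (U V : Type) (g : U -> V) : pred V :=
  fun v => `[< exists u, v = g u >].

Fact range_closed (A : nzRingType) (U V : lmodType A) (g : U -> V) :
  linear g -> subsemimod_closed (range g).
Proof.
move=> lin; have g0 : g 0 = 0.
  by have := lin (-1) 0 0; rewrite scaler0 add0r scaleN1r addNr.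
(do ?split) => [|v w /asboolP[b ->] /asboolP[c ->]|a v /asboolP[b ->]];
  apply/asboolP.
- by exists 0.
- by exists (b + c); rewrite -[b]scale1r lin !scale1r.
- by exists (a *: b); rewrite -[a *: b]addr0 lin g0 addr0.
Qed.

Section Product.
Variables (A : nzRingType) (I : finType) (T : I -> lmodType A).

Definition modprod : Type := {dffun forall i : I, T i}.
HB.instance Definition _ := Choice.on modprod.

Implicit Types f g h : modprod.

Definition mp_mk (e : forall i, T i) : modprod := finfun e.
Definition mp_at f i : T i := (f : {dffun forall i : I, T i}) i.

Lemma mp_mkE e i : mp_at (mp_mk e) i = e i.
Proof. exact: ffunE. Qed.

Lemma mp_ext f g : (forall i, mp_at f i = mp_at g i) -> f = g.
Proof. by move=> h; apply/ffunP. Qed.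

Definition mp_add f g := mp_mk (fun i => mp_at f i + mp_at g i).
Definition mp_opp f := mp_mk (fun i => - mp_at f i).
Definition mp_zero := mp_mk (fun i => 0).
Definition mp_scale a f := mp_mk (fun i => a *: mp_at f i).

Fact mp_addA : associative mp_add.
Proof. by move=> f g h; apply: mp_ext => i; rewrite !mp_mkE addrA. Qed.
Fact mp_addC : commutative mp_add.
Proof. by move=> f g; apply: mp_ext => i; rewrite !mp_mkE addrC. Qed.
Fact mp_add0 : left_id mp_zero mp_add.
Proof. by move=> f; apply: mp_ext => i; rewrite !mp_mkE add0r. Qed.
Fact mp_addN : left_inverse mp_zero mp_opp mp_add.
Proof. by move=> f; apply: mp_ext => i; rewrite !mp_mkE addNr. Qed.

HB.instance Definition _ :=
  GRing.isZmodule.Build modprod mp_addA mp_addC mp_add0 mp_addN.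

Fact mp_scaleA a b f : mp_scale a (mp_scale b f) = mp_scale (a * b) f.
Proof. by apply: mp_ext => i; rewrite !mp_mkE scalerA. Qed.
Fact mp_scale1 : left_id 1 mp_scale.
Proof. by move=> f; apply: mp_ext => i; rewrite !mp_mkE scale1r. Qed.
Fact mp_scaleDr : right_distributive mp_scale +%R.
Proof. by move=> a f g; apply: mp_ext => i; rewrite !mp_mkE scalerDr. Qed.
Fact mp_scaleDl f : {morph mp_scale^~ f : a b / a + b}.
Proof. by move=> a b; apply: mp_ext => i; rewrite !mp_mkE scalerDl. Qed.

HB.instance Definition _ := GRing.Zmodule_isLmodule.Build A modprod
  mp_scaleA mp_scale1 mp_scaleDr mp_scaleDl.

End Product.

Section Localization.
Variables (A : comNzRingType) (M : lmodType A) (u : A).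

(* [(m, a)] stands for the fraction [m / u ^ a]. *)
Definition loc_equiv (x y : M * nat) : bool :=
  `[< exists c : nat, u ^+ (c + y.2) *: x.1 = u ^+ (c + x.2) *: y.1 >].

Fact loc_equiv_is_equiv : equiv_class_of loc_equiv.
Proof.
split=> [x|x y|y x z].
- by apply/asboolP; exists 0%N.
- by apply/asboolP/asboolP => -[c e]; exists c.
- move=> /asboolP[c e] /asboolP[c' e']; apply/asboolP.
  exists (c + c' + y.2)%N.
  rewrite (_ : (c + c' + y.2 + z.2 = (c' + z.2) + (c + y.2))%N); last by lia.
  rewrite exprD -scalerA e scalerA mulrC -scalerA e' scalerA -exprD.
  by congr (_ ^+ _ *: _); lia.
Qed.

Canonical loc_equiv_equiv := EquivRelPack loc_equiv_is_equiv.
Canonical loc_equiv_encModRel := defaultEncModRel loc_equiv.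

Definition loc : Type := {eq_quot loc_equiv}.
HB.instance Definition _ := Choice.on loc.

Definition frac (m : M) (a : nat) : loc := \pi_({eq_quot loc_equiv}) (m, a).
Definition loc_num (x : loc) : M := (repr (x : {eq_quot loc_equiv})).1.
Definition loc_den (x : loc) : nat := (repr (x : {eq_quot loc_equiv})).2.

Lemma fracK x : frac (loc_num x) (loc_den x) = x.
Proof. by rewrite /frac /loc_num /loc_den -surjective_pairing; exact: reprK. Qed.

Lemma fracE m a m' a' :
  (frac m a = frac m' a') <->
  (exists c : nat, u ^+ (c + a') *: m = u ^+ (c + a) *: m').
Proof.
split=> [/eqP|h]; first by rewrite eqmodE => /asboolP.
by apply/eqP; rewrite eqmodE; apply/asboolP.
Qed.

Lemma loc_repr m a :
  exists c : nat,
    u ^+ (c + a) *: loc_num (frac m a) = u ^+ (c + loc_den (frac m a)) *: m.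
Proof. by apply/fracE; rewrite fracK. Qed.

Definition loc_add x y : loc :=
  frac (u ^+ loc_den y *: loc_num x + u ^+ loc_den x *: loc_num y)
       (loc_den x + loc_den y).
Definition loc_opp x : loc := frac (- loc_num x) (loc_den x).
Definition loc_zero : loc := frac 0 0.
Definition loc_scale b x : loc := frac (b *: loc_num x) (loc_den x).

Lemma loc_addE m a m' a' :
  loc_add (frac m a) (frac m' a') = frac (u ^+ a' *: m + u ^+ a *: m') (a + a').
Proof.
have [c e] := loc_repr m a; have [c' e'] := loc_repr m' a'.
rewrite /loc_add; move: (loc_num _) (loc_den _) e => p b e.
move: (loc_num _) (loc_den _) e' => p' b' e'.
apply/fracE; exists (c + c')%N; rewrite !scalerDr !scalerA -!exprD.
congr (_ + _).
- rewrite (_ : (c + c' + (a + a') + b' = (c' + a' + b') + (c + a))%N); last by lia.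
  rewrite exprD -scalerA e scalerA -exprD; congr (_ ^+ _ *: _); lia.
- rewrite (_ : (c + c' + (a + a') + b = (c + a + b) + (c' + a'))%N); last by lia.
  rewrite exprD -scalerA e' scalerA -exprD; congr (_ ^+ _ *: _); lia.
Qed.

Lemma loc_oppE m a : loc_opp (frac m a) = frac (- m) a.
Proof.
have [c e] := loc_repr m a.
by apply/fracE; exists c; rewrite !scalerN e.
Qed.

Lemma loc_scaleE b m a : loc_scale b (frac m a) = frac (b *: m) a.
Proof.
have [c e] := loc_repr m a; apply/fracE; exists c.
by rewrite !scalerA !(mulrC _ b) -!scalerA e.
Qed.

Lemma frac_expand e m a : frac (u ^+ e *: m) (e + a) = frac m a.
Proof. by apply/fracE; exists 0%N; rewrite scalerA -exprD; congr (_ ^+ _ *: _); lia. Qed.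

Lemma loc_addE1 m m' a : loc_add (frac m a) (frac m' a) = frac (m + m') a.
Proof. by rewrite loc_addE -scalerDr frac_expand. Qed.

Fact loc_addC : commutative loc_add.
Proof. by move=> x y; rewrite /loc_add addrC addnC. Qed.

Fact loc_addA : associative loc_add.
Proof.
move=> x y z; rewrite -[x]fracK -[y]fracK -[z]fracK !loc_addE.
rewrite !scalerDr !scalerA -!exprD !addrA addnA.
by congr (frac (_ *: _ + _ *: _ + _ *: _) _); congr (_ ^+ _); lia.
Qed.

Fact loc_add0 : left_id loc_zero loc_add.
Proof.
by move=> x; rewrite -[x]fracK loc_addE scaler0 add0r expr0 scale1r.
Qed.

Fact loc_addN : left_inverse loc_zero loc_opp loc_add.
Proof.
move=> x; rewrite -[x]fracK loc_oppE loc_addE1 addNr.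
by apply/fracE; exists 0%N; rewrite !scaler0.
Qed.

HB.instance Definition _ :=
  GRing.isZmodule.Build loc loc_addA loc_addC loc_add0 loc_addN.

Fact loc_scaleA b c x : loc_scale b (loc_scale c x) = loc_scale (b * c) x.
Proof. by rewrite -[x]fracK !loc_scaleE scalerA. Qed.
Fact loc_scale1 : left_id 1 loc_scale.
Proof. by move=> x; rewrite -[x]fracK loc_scaleE scale1r. Qed.
Fact loc_scaleDr : right_distributive loc_scale loc_add.
Proof.
move=> b x y; rewrite -[x]fracK -[y]fracK loc_addE !loc_scaleE loc_addE.
by rewrite scalerDr !scalerA !(mulrC b).
Qed.
Fact loc_scaleDl x : {morph loc_scale^~ x : b c / b + c >-> loc_add b c}.
Proof. by move=> b c; rewrite -[x]fracK !loc_scaleE loc_addE1 scalerDl. Qed.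

HB.instance Definition _ := GRing.Zmodule_isLmodule.Build A loc
  loc_scaleA loc_scale1 loc_scaleDr loc_scaleDl.

End Localization.

(* [M_u -> M_v], [m / u ^ a |-> w ^ a m / v ^ a]: the canonical map when
   [v = w * u]. *)
Definition loc_map (A : comNzRingType) (M : lmodType A) (u v w : A)
    (x : loc M u) : loc M v :=
  frac v (w ^+ loc_den x *: loc_num x) (loc_den x).

(* [phi_u : M_u -> M'_u], for [phi] linear. *)
Definition loc_fun (A : comNzRingType) (M M' : lmodType A) (u : A)
    (phi : M -> M') (x : loc M u) : loc M' u :=
  frac u (phi (loc_num x)) (loc_den x).

Section LocMap.
Variables (A : comNzRingType) (M : lmodType A) (u v w : A).
Hypothesis vE : v = w * u.

Lemma loc_mapE (m : M) a : loc_map v w (frac u m a) = frac v (w ^+ a *: m) a.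
Proof.
have [c e] := loc_repr u m a; apply/fracE; exists c.
rewrite vE !exprMn !scalerA.
rewrite (mulrAC _ _ (w ^+ loc_den _)) (mulrAC _ _ (w ^+ a)).
rewrite -!exprD -2!scalerA e.
by congr (_ ^+ _ *: _); lia.
Qed.

Lemma loc_map_linear : linear (loc_map v w : loc M u -> loc M v).
Proof.
move=> b x y; rewrite -[x]fracK -[y]fracK.
move: (loc_num x) (loc_den x) (loc_num y) (loc_den y) => m a m' a'.
rewrite [b *: _]loc_scaleE [_ + _ in LHS]loc_addE !loc_mapE.
rewrite [b *: _ in RHS]loc_scaleE [_ + _ in RHS]loc_addE.
congr (frac _ _ _); rewrite vE scalerDr !scalerA; congr (_ *: _ + _ *: _).
- by rewrite !exprMn exprD; ring.
- by rewrite !exprMn exprD; ring.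
Qed.

End LocMap.

(* The sign of the vertex [j] in the face [G]. *)
Definition face_sign (A : nzRingType) (n : nat) (G : {set 'I_n}) (j : 'I_n) : A :=
  (-1) ^+ #|[set l in G | (l < j)%N]|.

Section Cech.
Variables (A : comNzRingType) (n : nat) (x : 'I_n -> A) (J : {set 'I_n}).

Definition cech_index (p : nat) : finType :=
  {F : {set 'I_n} | (F \subset J) && (#|F| == p)}.

Definition xprod (F : {set 'I_n}) : A := \prod_(j in F) x j.

Definition cech (M : lmodType A) (p : nat) : lmodType A :=
  modprod (fun F : cech_index p => loc M (xprod (val F))).

(* Intended for [q = p + 1], in which case [val G :\ j] always is an index and
   [insub] does not fail. *)
Definition cech_diff (M : lmodType A) (p q : nat) (c : cech M p) : cech M q :=
  mp_mk (fun G : cech_index q =>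
    \sum_(j in val G) face_sign A (val G) j *:
      oapp (fun F : cech_index p => loc_map (xprod (val G)) (x j) (mp_at c F))
           0 (insub (val G :\ j))).

Lemma cech_diff_linear (M : lmodType A) p q : linear (@cech_diff M p q).
Proof.
move=> a b c; apply: mp_ext => G.
rewrite [mp_at (_ + _) _]mp_mkE [mp_at (_ *: _) _]mp_mkE !mp_mkE.
rewrite scaler_sumr -big_split /=; apply: eq_bigr => j jG.
case: insubP => [F _ FE|_] /=; last by rewrite !scaler0 addr0.
have vE : xprod (val G) = x j * xprod (val F) by rewrite /xprod FE (big_setD1 j).
rewrite [mp_at (_ + _) _]mp_mkE [mp_at (_ *: _) _]mp_mkE (loc_map_linear vE).
by rewrite scalerDr !scalerA (mulrC a).
Qed.

Definition cech_bound (M : lmodType A) (q : nat) : {pred cech M q} :=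
  match q return {pred cech M q} with
  | 0 => fun c => c == 0
  | p.+1 => range (@cech_diff M p p.+1)
  end.

Fact cech_bound_closed (M : lmodType A) q : subsemimod_closed (@cech_bound M q).
Proof.
case: q => [|p]; last exact/range_closed/cech_diff_linear.
(do ?split) => [|b c /eqP-> /eqP->|a c /eqP->]; first exact: eqxx.
  by rewrite addr0; apply: eqxx.
by rewrite scaler0; apply: eqxx.
Qed.

HB.instance Definition _ (M : lmodType A) q :=
  GRing.isSubmodClosed.Build A (cech M q) (@cech_bound M q)
    (@cech_bound_closed M q).

(* C^q / B^q. Local cohomology of [M] with support in the ideal (x_j : j in J)
   is the cohomology H^q = Z^q / B^q of the Cech complex of [M] on these
   generators, realized as the submodule of classes of cocycles in C^q / B^q. *)
Definition cech_quot (M : lmodType A) (q : nat) : lmodType A :=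
  quotmod (@cech_bound M q).

Definition lcoh_classes (M : lmodType A) (q : nat) (P : cech M q -> Prop) :
    cech_quot M q -> Prop :=
  image_of (quotmod_pi (@cech_bound M q))
           (fun z => cech_diff q.+1 z = 0 /\ P z).

Definition cech_fun (M M' : lmodType A) (phi : M -> M') (q : nat)
    (c : cech M q) : cech M' q :=
  mp_mk (fun F : cech_index q => loc_fun phi (mp_at c F)).

Definition lcoh_map (M M' : lmodType A) (phi : M -> M') (q : nat) :
    cech_quot M q -> cech_quot M' q :=
  quotmod_map (@cech_bound M' q) (@cech_fun M M' phi q).

End Cech.

Section RestrictScalars.
Variables (k : fieldType) (n : nat) (M : lmodType {mpoly k[n]}).

(* [M] as a vector space over [k]. *)
Definition restr : Type := M.
HB.instance Definition _ := GRing.Zmodule.on restr.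

Definition restr_scale (a : k) (m : restr) : restr := a%:MP_[n] *: (m : M).

Fact restr_scaleA a b m : restr_scale a (restr_scale b m) = restr_scale (a * b) m.
Proof. by rewrite /restr_scale scalerA mpolyCM. Qed.
Fact restr_scale1 : left_id 1 restr_scale.
Proof. by move=> m; rewrite /restr_scale scale1r. Qed.
Fact restr_scaleDr : right_distributive restr_scale +%R.
Proof. by move=> a m m'; rewrite /restr_scale scalerDr. Qed.
Fact restr_scaleDl m : {morph restr_scale^~ m : a b / a + b}.
Proof. by move=> a b; rewrite /restr_scale mpolyCD scalerDl. Qed.

HB.instance Definition _ := GRing.Zmodule_isLmodule.Build k restr
  restr_scaleA restr_scale1 restr_scaleDr restr_scaleDl.

End RestrictScalars.

Section StanleyReisner.
Variables (k : fieldType) (n : nat).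
Local Notation S := {mpoly k[n]}.
Implicit Type Gamma : {set {set 'I_n}}.

Definition SR_ideal Gamma : {pred S^o} :=
  fun p => `[< exists c : {set 'I_n} -> S,
    p = \sum_(tau : {set 'I_n} | tau \notin Gamma) c tau * \prod_(j in tau) 'X_j >].

Fact SR_ideal_closed Gamma : subsemimod_closed (SR_ideal Gamma).
Proof.
do ?split.
- by apply/asboolP; exists (fun=> 0); rewrite big1 // => tau _; rewrite mul0r.
- move=> p p' /asboolP[c ->] /asboolP[c' ->]; apply/asboolP.
  exists (fun tau => c tau + c' tau); rewrite -big_split /=.
  by apply: eq_bigr => tau _; rewrite mulrDl.
- move=> a p /asboolP[c ->]; apply/asboolP; exists (fun tau => a * c tau).
  by rewrite scaler_sumr; apply: eq_bigr => tau _; rewrite -mulrA.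
Qed.

HB.instance Definition _ Gamma :=
  GRing.isSubmodClosed.Build S S^o (SR_ideal Gamma) (SR_ideal_closed Gamma).

Definition SR Gamma : lmodType S := quotmod (SR_ideal Gamma).

(* The surjection k[Gamma] -> k[Gamma'], for Gamma' a subcomplex of Gamma. *)
Definition SR_map Gamma Gamma' : SR Gamma -> SR Gamma' :=
  quotmod_map (SR_ideal Gamma') (idfun : S^o -> S^o).

Definition S_deg (alpha : 'I_n -> int) (p : S) : Prop :=
  forall m, m \in msupp p -> forall j, (m j)%:Z = alpha j.

Definition SR_deg Gamma (alpha : 'I_n -> int) : SR Gamma -> Prop :=
  image_of (quotmod_pi (SR_ideal Gamma)) (@S_deg alpha).

Definition var (j : 'I_n) : S := 'X_j.

(* m / x_F ^ a is homogeneous of degree deg m - a deg x_F. *)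
Definition loc_deg Gamma (F : {set 'I_n}) (alpha : 'I_n -> int)
    (y : loc (SR Gamma) (xprod var F)) : Prop :=
  exists (m : SR Gamma) (a : nat),
    SR_deg (fun j => alpha j + (if j \in F then a%:Z else 0)) m /\
    y = frac (xprod var F) m a.

Definition cech_deg Gamma (J : {set 'I_n}) (q : nat) (alpha : 'I_n -> int)
    (c : cech var J (SR Gamma) q) : Prop :=
  forall F : cech_index J q, loc_deg alpha (mp_at c F).

(* H^q_{p_i}(k[Gamma])_alpha *)
Definition lcoh_deg Gamma (i : 'I_n) (q : nat) (alpha : 'I_n -> int) :
    cech_quot var [set~ i] (SR Gamma) q -> Prop :=
  lcoh_classes (@cech_deg Gamma [set~ i] q alpha).

(* The rank of H^q_{p_i}(k[Gamma])_alpha -> H^q_{p_i}(k[Gamma'])_alpha is [r]. *)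
Definition lcoh_rank Gamma Gamma' (i : 'I_n) (q : nat) (alpha : 'I_n -> int)
    (r : nat) : Prop :=
  has_rank_on
    (lcoh_map (@SR_map Gamma Gamma') (q := q) :
       _ -> restr (cech_quot var [set~ i] (SR Gamma') q))
    (lcoh_deg (Gamma := Gamma) (i := i) (q := q) alpha) r.

End StanleyReisner.

Section Complexes.
Variable n : nat.
Implicit Types (Gamma : {set {set 'I_n}}) (sigma tau : {set 'I_n}).

Definition simplicial_complex Gamma : Prop :=
  forall tau sigma, sigma \in Gamma -> tau \subset sigma -> tau \in Gamma.

Definition link Gamma sigma : {set {set 'I_n}} :=
  [set tau : {set 'I_n} | [disjoint tau & sigma] && (tau :|: sigma \in Gamma)].

Definition deletion Gamma (i : 'I_n) : {set {set 'I_n}} :=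
  [set tau in Gamma | i \notin tau].

Definition monotonic (R : realType) Gamma (f : {set 'I_n} -> R) : Prop :=
  forall tau sigma, tau \in Gamma -> sigma \in Gamma ->
    tau \subset sigma -> f tau <= f sigma.

Definition stage (R : realType) Gamma (f : {set 'I_n} -> R) (t : R) :
    {set {set 'I_n}} :=
  [set sigma in Gamma | f sigma <= t].

Definition supp_pos (i : 'I_n) (alpha : 'I_n -> int) : {set 'I_n} :=
  [set j | (j != i) && (0 < alpha j)].
Definition supp_neg (i : 'I_n) (alpha : 'I_n -> int) : {set 'I_n} :=
  [set j | (j != i) && (alpha j < 0)].

End Complexes.

Section ReducedCohomology.
Variables (k : fieldType) (n : nat).
Implicit Type Gamma : {set {set 'I_n}}.

(* The faces of dimension [d]; the empty face has dimension -1. *)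
Definition face Gamma (d : int) : finType :=
  {tau : {set 'I_n} | (tau \in Gamma) && (#|tau|%:Z == d + 1)}.

(* Both the [d]-chains and the [d]-cochains of [Gamma], in the standard basis. *)
Definition chain Gamma (d : int) : lmodType k := {ffun face Gamma d -> k^o}.

(* The value of [c] at [tau], and 0 when [tau] is not a [d]-face of [Gamma]. *)
Definition coef Gamma (d : int) (c : chain Gamma d) (tau : {set 'I_n}) : k :=
  oapp (c : {ffun face Gamma d -> k^o}) 0 (insub tau).

Definition coboundary Gamma (d e : int) (c : chain Gamma d) : chain Gamma e :=
  [ffun tau : face Gamma e =>
     \sum_(j in val tau) face_sign k (val tau) j * coef c (val tau :\ j)].

Definition boundary Gamma (d e : int) (c : chain Gamma d) : chain Gamma e :=
  [ffun tau : face Gamma e =>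
     \sum_(j | j \notin val tau)
        face_sign k (j |: val tau) j * coef c (j |: val tau)].

(* Between complexes: restriction of cochains to a subcomplex, and extension
   of chains (by zero) to a larger complex. *)
Definition transfer Gamma Gamma' (d : int) (c : chain Gamma d) : chain Gamma' d :=
  [ffun tau : face Gamma' d => coef c (val tau)].

Lemma coef_linear Gamma d a (b c : chain Gamma d) tau :
  coef (a *: b + c) tau = a * coef b tau + coef c tau.
Proof. by rewrite /coef; case: insub => [F|] /=; rewrite ?ffunE // mulr0 addr0. Qed.

Lemma coboundary_linear Gamma d e : linear (@coboundary Gamma d e).
Proof.
move=> a b c; apply/ffunP => tau; rewrite !ffunE scaler_sumr -big_split /=.
by apply: eq_bigr => j _; rewrite coef_linear mulrDr mulrCA.
Qed.

Lemma boundary_linear Gamma d e : linear (@boundary Gamma d e).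
Proof.
move=> a b c; apply/ffunP => tau; rewrite !ffunE scaler_sumr -big_split /=.
by apply: eq_bigr => j _; rewrite coef_linear mulrDr mulrCA.
Qed.

Definition coh_bound Gamma (d : int) : {pred chain Gamma d} :=
  range (@coboundary Gamma (d - 1) d).
HB.instance Definition _ Gamma d :=
  GRing.isSubmodClosed.Build k (chain Gamma d) (@coh_bound Gamma d)
    (range_closed (@coboundary_linear Gamma (d - 1) d)).

Definition hom_bound Gamma (d : int) : {pred chain Gamma d} :=
  range (@boundary Gamma (d + 1) d).
HB.instance Definition _ Gamma d :=
  GRing.isSubmodClosed.Build k (chain Gamma d) (@hom_bound Gamma d)
    (range_closed (@boundary_linear Gamma (d + 1) d)).

(* As for [cech_quot], reduced (co)homology is taken inside (co)chains modulo
   (co)boundaries. *)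
Definition coh_classes Gamma (d : int) : quotmod (@coh_bound Gamma d) -> Prop :=
  image_of (quotmod_pi (@coh_bound Gamma d))
           (fun z => coboundary (d + 1) z = 0).

Definition hom_classes Gamma (d : int) : quotmod (@hom_bound Gamma d) -> Prop :=
  image_of (quotmod_pi (@hom_bound Gamma d))
           (fun z => boundary (d - 1) z = 0).

(* For Gamma' a subcomplex of Gamma: the rank of the restriction
   H^d(Gamma) -> H^d(Gamma') is [r]. *)
Definition coh_rank Gamma Gamma' (d : int) (r : nat) : Prop :=
  has_rank_on
    (quotmod_map (@coh_bound Gamma' d) (@transfer Gamma Gamma' d))
    (@coh_classes Gamma d) r.

(* For Gamma' a subcomplex of Gamma: the rank of H_d(Gamma') -> H_d(Gamma)
   is [r]. *)
Definition hom_rank Gamma' Gamma (d : int) (r : nat) : Prop :=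
  has_rank_on
    (quotmod_map (@hom_bound Gamma d) (@transfer Gamma' Gamma d))
    (@hom_classes Gamma' d) r.

End ReducedCohomology.

(* Main.v *)
(* In degree alpha = (c; b) the localization k[Gamma]_(x_F) is a line spanned by
   x^alpha when supp_-(alpha) is contained in F and F u supp_+(alpha) is a face
   of Gamma, and it is zero otherwise. So the degree alpha part of the Cech
   complex on the x_j, j != i, is the cochain complex on the family of those
   F ("cells"), with the simplicial coboundary, and the surjection between two
   stages becomes restriction of cochains. If some j != i has alpha j > 0, the
   family is stable under adding and removing j, and the cone homotopy kills
   every cocycle. Otherwise F |-> F \ sigma identifies the cells with the faces
   of the link in the statement, up to the shuffle sign of sigma. Finally, the
   maps in cohomology and in homology have the same rank because both are the
   rank of the pairing between d-cocycles of the large complex and d-cycles of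
   the small one. *)
From HB Require Import structures.
From mathcomp Require Import all_boot all_order all_algebra.
From mathcomp Require Import boolp reals.
From mathcomp Require Import mpoly zify ring.
Require Import Defs.

Set Implicit Arguments.
Unset Strict Implicit.
Unset Printing Implicit Defensive.

Import Order.TTheory GRing.Theory Num.Theory.
Local Open Scope ring_scope.

(** * Linearity rules for bare functions satisfying [linear] *)

Section LinearFunction.
Variables (A : pzRingType) (U V : lmodType A) (g : U -> V).
Hypothesis lin : linear g.

Let h : {linear U -> V} := HB.pack g (GRing.isLinear.Build _ _ _ _ g lin).

Lemma linearfun0 : g 0 = 0.
Proof. exact: (linear0 h). Qed.

Lemma linearfunB x y : g (x - y) = g x - g y.
Proof. exact: (linearB h). Qed.

Lemma linearfunZ a x : g (a *: x) = a *: g x.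
Proof. exact: (linearZZ h). Qed.

Lemma linearfun_sum (I : Type) (r : seq I) (P : pred I) (F : I -> U) :
  g (\sum_(l <- r | P l) F l) = \sum_(l <- r | P l) g (F l).
Proof. exact: (linear_sum h). Qed.

Lemma linearfun_comb (I : finType) (a : I -> A) (F : I -> U) :
  g (\sum_l a l *: F l) = \sum_l a l *: g (F l).
Proof. by rewrite linearfun_sum; apply: eq_bigr => l _; rewrite linearfunZ. Qed.

End LinearFunction.

(** * Dimensions of images and ranks of subquotient maps *)

Section LinearAlgebra.
Variable k : fieldType.

Lemma eq_has_dim (V : lmodType k) (W W' : V -> Prop) r :
  (forall w, W w <-> W' w) -> has_dim W r -> has_dim W' r.
Proof.
move=> WE [v [Wv free gen]]; exists v; split=> // [a|w /WE]; last exact: gen.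
exact/WE.
Qed.

Lemma has_dim0 (V : lmodType k) (W : V -> Prop) :
  (forall w, W w <-> w = 0) -> has_dim W 0.
Proof.
move=> WE; exists (fun=> 0); split=> [a|a _ []//|w /WE ->].
  by apply/WE; rewrite big_ord0.
by exists (fun=> 0); rewrite big_ord0.
Qed.

(** Both images are the quotient of [P] by the same kernel. A basis of the first is lifted to [P]
    and pushed forward along [g']. *)
Lemma has_dim_transport (U V V' : lmodType k) (P : U -> Prop)
    (g : U -> V) (g' : U -> V') r :
  linear g -> linear g' ->
  P 0 -> (forall a z z', P z -> P z' -> P (a *: z + z')) ->
  (forall z, P z -> g z = 0 <-> g' z = 0) ->
  has_dim (image_of g P) r -> has_dim (image_of g' P) r.
Proof.
move=> lin lin' P0 Plin kerE [v [Wv free gen]].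
have Psum (a : 'I_r -> k) z : (forall l, P (z l)) -> P (\sum_l a l *: z l).
  by move=> Pz; elim/big_rec: _ => // l y _; apply: Plin.
have PB z z' : P z -> P z' -> P (z - z').
  by rewrite addrC -scaleN1r => Pz Pz'; apply: Plin.
(* Each basis vector is the combination with Kronecker delta coefficients, hence lies in the image
   and has a lift in [P]. *)
have /choice[z zP] : forall l, exists z, P z /\ v l = g z.
  move=> l; have := Wv (fun l' => (l' == l)%:R).
  rewrite (bigD1 l) //= eqxx scale1r big1 ?addr0 => [[z Pz ->]|l' /negPf->].
    by exists z.
  by rewrite scale0r.
have gsum a : \sum_l a l *: v l = g (\sum_l a l *: z l).
  by rewrite linearfun_comb //; apply: eq_bigr => l _; rewrite (zP l).2.
exists (fun l => g' (z l)); split=> [a|a|w [u Pu ->]].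
- exists (\sum_l a l *: z l); last by rewrite linearfun_comb.
  by apply: Psum => l; case: (zP l).
- rewrite -linearfun_comb // => e; apply: free.
  rewrite gsum; apply/kerE => //; apply: Psum => l; by case: (zP l).
- have [|a ga] := gen (g u); first by exists u.
  exists a; rewrite -linearfun_comb //.
  have Pz : P (\sum_l a l *: z l) by apply: Psum => l; case: (zP l).
  apply/eqP; rewrite -subr_eq0 -linearfunB //; apply/eqP/kerE; first exact: PB.
  by rewrite linearfunB // ga gsum subrr.
Qed.

(** The image of [g] is the space of rows modulo the left kernel of [A], hence isomorphic to the row
    space of [A]. The rows of [C] below are preimages of a basis of that row space. *)
Lemma has_dim_mx (V : lmodType k) m p (A : 'M[k]_(m, p)) (g : 'rV_m -> V) :
  linear g -> (forall u, g u = 0 <-> u *m A = 0) ->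
  has_dim (fun w => exists u, w = g u) (\rank A).
Proof.
move=> lin kerE.
pose B := row_base A.
have /submxP[C CE] : (B <= A)%MS by rewrite eq_row_base.
have sumE (a : 'I_(\rank A) -> k) :
    \sum_l a l *: g (row l C) = g ((\row_l a l) *m C).
  rewrite -linearfun_comb //; congr g; rewrite mulmx_sum_row.
  by apply: eq_bigr => l _; rewrite mxE.
exists (fun l => g (row l C)); split=> [a|a|_ [u ->]].
- by exists ((\row_l a l) *m C); rewrite sumE.
- rewrite sumE => /kerE; rewrite -mulmxA -CE => /eqP.
  rewrite mulmx_free_eq0 ?row_base_free // => /eqP/rowP a0 l.
  by have := a0 l; rewrite !mxE.
- have /submxP[a aE] : (u *m A <= B)%MS by rewrite eq_row_base submxMl.
  exists (a 0); rewrite sumE.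
  have -> : \row_l a 0 l = a by apply/rowP => l; rewrite mxE.
  apply/eqP; rewrite -subr_eq0 -linearfunB //; apply/eqP/kerE.
  by rewrite mulmxBl -mulmxA -CE -aE subrr.
Qed.

(** The rows of [kermx D1] span the cocycles, and right multiplication by [cokermx D0] kills exactly
    the coboundaries, so the matrix product represents the map on cohomology. *)
Lemma has_dim_subquotient (V : lmodType k) x x1 y y0 (D1 : 'M[k]_(x, x1))
    (T : 'M[k]_(x, y)) (D0 : 'M[k]_(y0, y)) (g : 'rV_y -> V) :
  linear g -> (forall v, g v = 0 <-> (v <= D0)%MS) ->
  has_dim (fun w => exists2 z, z *m D1 = 0 & w = g (z *m T))
    (\rank (kermx D1 *m T *m cokermx D0)).
Proof.
move=> lin kerE.
apply: (@eq_has_dim _ (fun w => exists u, w = g (u *m (kermx D1 *m T)))) => [w|].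
  split=> [[u ->]|[z /sub_kermxP/submxP[u ->] ->]].
    by exists (u *m kermx D1); rewrite -mulmxA // mulmx_ker mulmx0.
  by exists u; rewrite mulmxA.
apply: has_dim_mx => [a u v|u]; first by rewrite mulmxDl -scalemxAl lin.
by rewrite kerE mulmxA submxE !mulmxA; split=> /eqP.
Qed.

Lemma tr_cokermx m n (A : 'M[k]_(m, n)) : ((cokermx A)^T == kermx A^T)%MS.
Proof.
have sub : ((cokermx A)^T <= kermx A^T)%MS.
  by apply/sub_kermxP; rewrite -trmx_mul mulmx_coker trmx0.
rewrite -(mxrank_leqif_eq sub) mxrank_tr mxrank_coker mxrank_ker mxrank_tr.
exact: eqxx.
Qed.

(** Up to a change of spanning rows and columns, both products are the matrix of one pairing between
    cocycles and cycles, read in the two directions. *)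
Lemma mxrank_subquotient_tr x x1 y y0 (D1 : 'M[k]_(x, x1))
    (T : 'M[k]_(x, y)) (D0 : 'M[k]_(y0, y)) :
  \rank (kermx D0^T *m T^T *m cokermx D1^T)
    = \rank (kermx D1 *m T *m cokermx D0).
Proof.
(* Transposition exchanges kernel and cokernel only up to equality of row spaces, so each exchange
   is made in the leftmost factor, with a transposition of the whole product in between. *)
rewrite -mulmxA -mxrank_tr (trmx_mul (kermx _)) (trmx_mul T^T) trmxK -mulmxA.
rewrite (eqmxMr _ (eqmxP (tr_cokermx D1^T))) trmxK mulmxA -mxrank_tr.
rewrite (trmx_mul _ (kermx _)^T) trmxK -(eqmxMr _ (eqmxP (tr_cokermx D0))).
by rewrite -(trmx_mul _ (cokermx _)) mxrank_tr.
Qed.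

End LinearAlgebra.

(** * Projections to quotient modules and the induced maps *)

Section Quotients.
Variables (A : nzRingType) (V V' : lmodType A).
Variables (N : submodClosed V) (N' : submodClosed V').

Lemma quotmod_pi_linear : linear (quotmod_pi N).
Proof. by move=> a u v; rewrite quotmod_piD -quotmod_scale_pi. Qed.

Lemma quotmod_pi_eq0 v : quotmod_pi N v = 0 <-> v \in N.
Proof.
by rewrite -(linearfun0 quotmod_pi_linear) quotmod_piE subr0.
Qed.

Lemma quotmod_map_pi (phi : V -> V') v :
  linear phi -> (forall u, u \in N -> phi u \in N') ->
  quotmod_map N' phi (quotmod_pi N v) = quotmod_pi N' (phi v).
Proof.
move=> lin sub; apply/quotmod_piE; rewrite -linearfunB //; apply: sub.
by apply/quotmod_piE; rewrite quotmod_reprK.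
Qed.

End Quotients.

(** * Matrices of linear maps between spaces of functions on finite sets *)

Section FfunDuality.
Variable k : fieldType.
Local Notation "{ 'fun' X }" := {ffun X -> k^o} (at level 0, X at level 50).

Section Rows.
Variable X : finType.

Definition ffun_row (c : {fun X}) : 'rV[k]_#|X| := \row_l c (enum_val l).
Definition row_ffun (u : 'rV[k]_#|X|) : {fun X} := [ffun x => u 0 (enum_rank x)].

Lemma ffun_rowK : cancel ffun_row row_ffun.
Proof. by move=> c; apply/ffunP => x; rewrite ffunE mxE enum_rankK. Qed.

Lemma row_ffunK : cancel row_ffun ffun_row.
Proof. by move=> u; apply/rowP => l; rewrite mxE ffunE enum_valK. Qed.

Lemma ffun_row0 : ffun_row 0 = 0.
Proof. by apply/rowP => l; rewrite !mxE ffunE. Qed.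

Lemma row_ffun_linear : linear row_ffun.
Proof. by move=> a u v; apply/ffunP => x; rewrite !ffunE !mxE. Qed.

End Rows.

(** Kernel is meant here as in an integral kernel [D x y], not as a null space. *)
Definition kernel_mx (X Y : finType) (D : X -> Y -> k) : 'M[k]_(#|X|, #|Y|) :=
  \matrix_(l, m) D (enum_val l) (enum_val m).

Definition has_kernel (X Y : finType) (D : X -> Y -> k)
    (h : {fun X} -> {fun Y}) : Prop :=
  forall c y, h c y = \sum_x c x * D x y.

Lemma has_kernel_row (X Y : finType) (D : X -> Y -> k) h c :
  has_kernel D h -> ffun_row (h c) = ffun_row c *m kernel_mx D.
Proof.
move=> hE; apply/rowP => m; rewrite !mxE hE (reindex (@enum_val X X)) /=.
  by apply: eq_bigr => l _; rewrite !mxE.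
by exists (@enum_rank X) => x _; rewrite ?enum_rankK ?enum_valK.
Qed.

Lemma has_dim_ffun_subquotient (X X1 Y Y0 : finType) (D1 : X -> X1 -> k)
    (T : X -> Y -> k) (D0 : Y0 -> Y -> k) h1 hT h0 (V : lmodType k)
    (g : {fun Y} -> V) :
  has_kernel D1 h1 -> has_kernel T hT -> has_kernel D0 h0 -> linear g ->
  (forall v, g v = 0 <-> exists w, v = h0 w) ->
  has_dim (image_of (g \o hT) (fun z => h1 z = 0))
    (\rank (kermx (kernel_mx D1) *m kernel_mx T *m cokermx (kernel_mx D0))).
Proof.
move=> e1 eT e0 lin kerE.
apply: (@eq_has_dim _ _ (fun w => exists2 z, z *m kernel_mx D1 = 0 &
    w = g (row_ffun (z *m kernel_mx T)))) => [w|]; last first.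
  apply: (@has_dim_subquotient k V _ _ _ _ _ _ _ (g \o @row_ffun Y)) => [a u v|v] /=.
    by rewrite row_ffun_linear lin.
  rewrite kerE; split=> [[w vE]|/submxP[u ->]].
    by rewrite -[v]row_ffunK vE (has_kernel_row _ e0) submxMl.
  by exists (row_ffun u); rewrite -[h0 _]ffun_rowK (has_kernel_row _ e0) row_ffunK.
split=> [[z z0 ->]|[z z0 ->]].
  exists (row_ffun z); last first.
    by rewrite /= -[hT _]ffun_rowK (has_kernel_row _ eT) row_ffunK.
  rewrite -[h1 _]ffun_rowK (has_kernel_row _ e1) row_ffunK z0.
  exact: linearfun0 (@row_ffun_linear _).
exists (ffun_row z).
  by rewrite -(has_kernel_row _ e1) z0 ffun_row0.
by rewrite -(has_kernel_row _ eT) ffun_rowK.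
Qed.

Lemma kernel_mx_tr (X Y : finType) (D : X -> Y -> k) :
  kernel_mx (fun y x => D x y) = (kernel_mx D)^T.
Proof. by apply/matrixP => l m; rewrite !mxE. Qed.

End FfunDuality.

(** * Chains and cochains on families of sets, and equality of the two ranks *)

Section Chains.
Variables (k : fieldType) (n : nat).
Implicit Types (Gamma : {set {set 'I_n}}) (tau : {set 'I_n}) (d e : int).

Lemma coef_val Gamma d (c : chain k Gamma d) (F : face Gamma d) :
  coef c (val F) = c F.
Proof. by rewrite /coef valK. Qed.

Lemma coef_eq0 Gamma d (c : chain k Gamma d) tau :
  ~~ ((tau \in Gamma) && (#|tau|%:Z == d + 1)) -> coef c tau = 0.
Proof. by rewrite /coef => h; rewrite insubN. Qed.

Lemma coef_notin Gamma d (c : chain k Gamma d) tau :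
  tau \notin Gamma -> coef c tau = 0.
Proof. by move=> h; rewrite coef_eq0 // (negPf h). Qed.

Lemma coef_ffun Gamma d (E : {set 'I_n} -> k) tau :
  coef ([ffun F : face Gamma d => E (val F)] : chain k Gamma d) tau
    = if (tau \in Gamma) && (#|tau|%:Z == d + 1) then E tau else 0.
Proof.
by rewrite /coef; case: insubP => [F -> <-|/negPf->] //=; rewrite ffunE.
Qed.

Lemma coefP Gamma d (c c' : chain k Gamma d) :
  (forall tau, tau \in Gamma -> #|tau|%:Z = d + 1 -> coef c tau = coef c' tau) ->
  c = c'.
Proof.
move=> h; apply/ffunP => F; rewrite -!coef_val.
by case/andP: (valP F) => F1 /eqP F2; apply: h.
Qed.

Lemma coef_transfer Gamma Gamma' d (c : chain k Gamma d) tau :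
  coef (transfer Gamma' c) tau = if tau \in Gamma' then coef c tau else 0.
Proof.
rewrite coef_ffun; case: (tau \in Gamma') => //=; case: ifP => // h.
by rewrite coef_eq0 // h andbF.
Qed.

Lemma coef_coboundary Gamma d e (c : chain k Gamma d) tau : e = d + 1 ->
  coef (coboundary e c) tau =
    if tau \in Gamma then
      \sum_(j in tau) face_sign k tau j * coef c (tau :\ j) else 0.
Proof.
move=> ->; rewrite (@coef_ffun _ (d + 1)
  (fun tau => \sum_(j in tau) face_sign k tau j * coef c (tau :\ j))).
(* No condition on the size of [tau] is needed in the formula: for a wrong size, every [tau :\ j]
   has a wrong size too and the sum is zero. *)
case: (tau \in Gamma) => //=; case: eqP => // h; rewrite big1 // => j jt.
rewrite coef_eq0 ?mulr0 // negb_and; apply/orP; right; apply/eqP => h'.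
by apply: h; rewrite (cardsD1 j tau) jt PoszD h' addrC.
Qed.

Lemma coboundary_eq0 Gamma d e (c : chain k Gamma d) tau : e = d + 1 ->
  coboundary e c = 0 -> tau \in Gamma ->
  \sum_(j in tau) face_sign k tau j * coef c (tau :\ j) = 0.
Proof.
move=> ed c0 tG; have := coef_coboundary c tau ed.
by rewrite tG => <-; rewrite c0 /coef; case: insub => //= F; rewrite ffunE.
Qed.

Lemma transfer_linear Gamma Gamma' d : linear (@transfer k n Gamma Gamma' d).
Proof. by move=> a b c; apply/ffunP => F; rewrite !ffunE coef_linear. Qed.

(* What is left of "subcomplex" for families of sets that are not complexes:
   [Gamma'] inherits the codimension-one incidences of [Gamma]. *)
Definition subfamily Gamma' Gamma : Prop :=
  Gamma' \subset Gamma /\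
  forall tau j, tau \in Gamma' -> tau :\ j \in Gamma -> tau :\ j \in Gamma'.

(** A term [tau :\ j] lost by restricting to [Gamma'] was not in [Gamma] either, so it contributed
    nothing before. *)
Lemma transfer_coboundary Gamma Gamma' d e (c : chain k Gamma d) :
  subfamily Gamma' Gamma ->
  transfer Gamma' (coboundary e c) = coboundary e (transfer Gamma' c).
Proof.
move=> [/subsetP sub cl]; apply/ffunP => F; rewrite !ffunE.
have /andP[F1 F2] := valP F.
rewrite (@coef_ffun _ e
  (fun tau => \sum_(j in tau) face_sign k tau j * coef c (tau :\ j))).
rewrite sub // F2 /=; apply: eq_bigr => j jF; rewrite coef_transfer.
case: ifPn => // h; rewrite coef_notin //; apply: contra h; exact: cl.
Qed.

Lemma transfer_boundary Gamma Gamma' d e (c : chain k Gamma' d) :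
  subfamily Gamma' Gamma ->
  transfer Gamma (boundary e c) = boundary e (transfer Gamma c).
Proof.
move=> [/subsetP sub cl]; apply/ffunP => F; rewrite !ffunE.
have /andP[F1 F2] := valP F.
rewrite (@coef_ffun _ e (fun tau => \sum_(j | j \notin tau)
  face_sign k (j |: tau) j * coef c (j |: tau))) F2 andbT.
have coefT tau : coef (transfer Gamma c) tau = coef c tau.
  rewrite coef_transfer; case: ifPn => // h; rewrite coef_notin //.
  by apply: contra h; exact: sub.
transitivity (\sum_(j | j \notin val F)
    face_sign k (j |: val F) j * coef c (j |: val F)); last first.
  by apply: eq_bigr => j _; rewrite coefT.
case: ifPn => // h; rewrite big1 // => j jF; rewrite coef_notin ?mulr0 //.
apply: contra h => h; have := cl _ j h; rewrite setU1K //; exact.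
Qed.

Lemma coh_boundP Gamma d (c : chain k Gamma d) :
  reflect (exists b : chain k Gamma (d - 1), c = coboundary d b)
    (c \in @coh_bound k n Gamma d).
Proof. exact: asboolP. Qed.

Lemma hom_boundP Gamma d (c : chain k Gamma d) :
  reflect (exists b : chain k Gamma (d + 1), c = boundary d b)
    (c \in @hom_bound k n Gamma d).
Proof. exact: asboolP. Qed.

Lemma coh_pi_eq0 Gamma d (c : chain k Gamma d) :
  quotmod_pi (@coh_bound k n Gamma d) c = 0 <->
  exists b : chain k Gamma (d - 1), c = coboundary d b.
Proof. by rewrite quotmod_pi_eq0; split=> /coh_boundP. Qed.

Lemma hom_pi_eq0 Gamma d (c : chain k Gamma d) :
  quotmod_pi (@hom_bound k n Gamma d) c = 0 <->
  exists b : chain k Gamma (d + 1), c = boundary d b.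
Proof. by rewrite quotmod_pi_eq0; split=> /hom_boundP. Qed.

(** Restriction preserves coboundaries, so the rank can be computed on cocycles, without passing to
    classes in the source. *)
Lemma coh_rankE Gamma Gamma' d r : subfamily Gamma' Gamma ->
  coh_rank k Gamma Gamma' d r <->
  has_dim (image_of (quotmod_pi (@coh_bound k n Gamma' d)
      \o @transfer k n Gamma Gamma' d)
    (fun z : chain k Gamma d => coboundary (d + 1) z = 0)) r.
Proof.
move=> sub.
have mapE z : quotmod_map (@coh_bound k n Gamma' d)
      (@transfer k n Gamma Gamma' d)
        (quotmod_pi (@coh_bound k n Gamma d) z)
    = quotmod_pi _ (transfer Gamma' z).
  apply: quotmod_map_pi => [|_ /coh_boundP[u ->]]; first exact: transfer_linear.
  by apply/coh_boundP; exists (transfer Gamma' u); exact: transfer_coboundary.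
split; apply: eq_has_dim => w; split.
- by move=> [_ [z z0 ->] ->]; exists z; rewrite ?mapE.
- by move=> [z z0 ->]; exists (quotmod_pi _ z); rewrite ?mapE //; exists z.
- by move=> [z z0 ->]; exists (quotmod_pi _ z); rewrite ?mapE //; exists z.
- by move=> [_ [z z0 ->] ->]; exists z; rewrite ?mapE.
Qed.

Lemma hom_rankE Gamma Gamma' d r : subfamily Gamma' Gamma ->
  hom_rank k Gamma' Gamma d r <->
  has_dim (image_of (quotmod_pi (@hom_bound k n Gamma d)
      \o @transfer k n Gamma' Gamma d)
    (fun z : chain k Gamma' d => boundary (d - 1) z = 0)) r.
Proof.
move=> sub.
have mapE z : quotmod_map (@hom_bound k n Gamma d)
      (@transfer k n Gamma' Gamma d)
        (quotmod_pi (@hom_bound k n Gamma' d) z)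
    = quotmod_pi _ (transfer Gamma z).
  apply: quotmod_map_pi => [|_ /hom_boundP[u ->]]; first exact: transfer_linear.
  by apply/hom_boundP; exists (transfer Gamma u); exact: transfer_boundary.
split; apply: eq_has_dim => w; split.
- by move=> [_ [z z0 ->] ->]; exists z; rewrite ?mapE.
- by move=> [z z0 ->]; exists (quotmod_pi _ z); rewrite ?mapE //; exists z.
- by move=> [z z0 ->]; exists (quotmod_pi _ z); rewrite ?mapE //; exists z.
- by move=> [_ [z z0 ->] ->]; exists z; rewrite ?mapE.
Qed.

(** The sum has at most one term: it is the incidence number of [rho] in [tau]. *)
Definition incidence Gamma d e (rho : face Gamma d) (tau : face Gamma e) : k :=
  \sum_(j | (j \in val tau) && (val tau :\ j == val rho)) face_sign k (val tau) j.

Lemma coef_sum Gamma d (c : chain k Gamma d) tau :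
  coef c tau = \sum_(F : face Gamma d) c F * (val F == tau)%:R.
Proof.
rewrite /coef; case: insubP => [F _ <-|h] /=.
  rewrite (bigD1 F) //= eqxx mulr1 big1 ?addr0 // => F' FF'.
  by rewrite (inj_eq val_inj) (negPf FF') mulr0.
rewrite big1 // => F _; case: eqP => [E|_]; last by rewrite mulr0.
by move: h; rewrite -E (valP F).
Qed.

Lemma coboundary_kernel Gamma d e :
  has_kernel (@incidence Gamma d e) (@coboundary k n Gamma d e).
Proof.
move=> c F; rewrite ffunE.
under eq_bigr do rewrite coef_sum mulr_sumr.
rewrite exchange_big /=; apply: eq_bigr => F' _.
rewrite mulr_sumr big_mkcondr; apply: eq_bigr => j _.
by rewrite eq_sym; case: eqP => _; rewrite ?mulr1 ?mulr0 // mulrC.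
Qed.

Lemma boundary_kernel Gamma d e :
  has_kernel (fun F G => @incidence Gamma e d G F)
    (@boundary k n Gamma d e).
Proof.
move=> c F; rewrite ffunE.
under eq_bigr do rewrite coef_sum mulr_sumr.
rewrite exchange_big /=; apply: eq_bigr => F' _.
rewrite mulr_sumr.
transitivity (\sum_(j | (j \notin val F) && (val F' == j |: val F))
    c F' * face_sign k (val F') j).
  rewrite [in RHS]big_mkcondr; apply: eq_bigr => j _.
  by rewrite /=; case: eqP => [->|_]; rewrite ?mulr1 ?mulr0 // mulrC.
(* Adding [j] to the small face and removing it from the large one are inverse, so the boundary has
   the transposed incidence matrix. *)
apply: eq_bigl => j; apply/andP/andP => -[h /eqP E].
  by rewrite E setU11 setU1K.
by rewrite -E setD11 setD1K.
Qed.

Lemma transfer_kernel Gamma Gamma' d :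
  has_kernel (fun (rho : face Gamma d) (tau : face Gamma' d) =>
      (val rho == val tau)%:R) (@transfer k n Gamma Gamma' d).
Proof. by move=> c F; rewrite ffunE coef_sum. Qed.

(** The matrices of boundary, coboundary and the two transfers are transposes of each other, and
    [mxrank_subquotient_tr] applies. *)
Lemma coh_hom_rank Gamma Gamma' d : subfamily Gamma' Gamma ->
  exists r, coh_rank k Gamma Gamma' d r /\ hom_rank k Gamma' Gamma d r.
Proof.
move=> sub; eexists; rewrite coh_rankE // hom_rankE //; split.
  apply: has_dim_ffun_subquotient; first exact: coboundary_kernel.
  - exact: transfer_kernel.
  - exact: (@coboundary_kernel _ (d - 1) d).
  - exact: quotmod_pi_linear.
  - by move=> v; apply: coh_pi_eq0.
rewrite -mxrank_subquotient_tr -!kernel_mx_tr.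
apply: has_dim_ffun_subquotient; first exact: (@boundary_kernel _ d (d - 1)).
- move=> c F; rewrite transfer_kernel; apply: eq_bigr => F' _.
  by rewrite eq_sym.
- exact: (@boundary_kernel _ (d + 1) d).
- exact: quotmod_pi_linear.
- by move=> v; apply: hom_pi_eq0.
Qed.

End Chains.

(** This is transport along a parametrization [h] of [P'] by [P]. No [k]-structure is asked of [U'],
    so that it can be a Cech module over the polynomial ring. *)
Lemma has_dim_transport_image (k : fieldType) (U V V' : lmodType k) (U' : Type)
    (P : U -> Prop) (P' : U' -> Prop) (g : U -> V) (g' : U' -> V') (h : U -> U')
    r :
  linear g -> linear (g' \o h) ->
  P 0 -> (forall a z z', P z -> P z' -> P (a *: z + z')) ->
  (forall z, P z -> P' (h z)) -> (forall z', P' z' -> exists2 z, P z & z' = h z) ->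
  (forall z, P z -> g z = 0 <-> g' (h z) = 0) ->
  has_dim (image_of g P) r -> has_dim (image_of g' P') r.
Proof.
move=> lin lin' P0 Plin sub sur kerE hr.
apply: (eq_has_dim _ (has_dim_transport lin lin' P0 Plin kerE hr)) => w.
split=> [[z Pz ->]|[z' /sur[z Pz ->] ->]]; last by exists z.
by exists (h z) => //; exact: sub.
Qed.

(** * Sign identities *)

Section FaceSign.
Variables (A : comNzRingType) (n : nat).
Implicit Types (G sigma : {set 'I_n}) (j v : 'I_n).

Lemma face_sign_sqr G j : face_sign A G j * face_sign A G j = 1.
Proof. by rewrite /face_sign -expr2 sqrr_sign. Qed.

Lemma face_signD1 G j v : v \in G ->
  face_sign A G j = (-1) ^+ (v < j)%N * face_sign A (G :\ v) j.
Proof.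
move=> vG; rewrite /face_sign -exprD; congr (_ ^+ _).
rewrite [LHS](cardsD1 v) inE vG; congr (_ + _)%N.
by apply: eq_card => l; rewrite !inE andbA.
Qed.

(** Exactly one of the two vertices precedes the other, so exactly one of the two signs changes on
    removal. This is the cancellation behind the vanishing of a double coboundary. *)
Lemma face_sign_swap G j v : j \in G -> v \in G -> j != v ->
  face_sign A (G :\ v) j * face_sign A (G :\ j) v =
    - (face_sign A G v * face_sign A G j).
Proof.
move=> jG vG jv; rewrite (face_signD1 v jG) (face_signD1 j vG).
have -> : (v < j)%N = ~~ (j < v)%N by move: jv; rewrite -(inj_eq val_inj) /=; lia.
by case: (j < v)%N; rewrite /= expr0 expr1; ring.
Qed.

(* The sign of the shuffle putting [sigma] before [tau]. *)
Definition shuffle_sign sigma (tau : {set 'I_n}) : A :=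
  \prod_(j in tau) face_sign A sigma j.

Lemma shuffle_sign_sqr sigma tau :
  shuffle_sign sigma tau * shuffle_sign sigma tau = 1.
Proof. by rewrite -big_split big1 //= => j _; rewrite face_sign_sqr. Qed.

(** The vertices of [G] before [j] split into those in [sigma] and those outside. Hence the shuffle
    sign turns the coboundary of [G] into that of [G :\: sigma]. *)
Lemma face_sign_shuffle sigma G j :
  sigma \subset G -> j \in G -> j \notin sigma ->
  face_sign A G j * shuffle_sign sigma ((G :\ j) :\: sigma) =
    shuffle_sign sigma (G :\: sigma) * face_sign A (G :\: sigma) j.
Proof.
move=> sG jG js.
have -> : (G :\ j) :\: sigma = (G :\: sigma) :\ j.
  by apply/setP => l; rewrite !inE andbCA.
rewrite [in RHS]/shuffle_sign (big_setD1 j) ?inE ?js //= -/(shuffle_sign _ _).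
rewrite mulrAC -[in RHS]/(_ * _); congr (_ * _).
rewrite /face_sign -exprD; congr (_ ^+ _).
rewrite -cardsUI [X in (_ + X)%N](_ : _ = 0%N) ?addn0.
  apply: eq_card => l; rewrite !inE.
  have := subsetP sG l; case: (l \in sigma) => [/(_ isT)->|_] /=; by rewrite ?orbF.
apply/eqP; rewrite cards_eq0; apply/eqP/setP => l; rewrite !inE.
by case: (l \in sigma) => //=; rewrite andbF.
Qed.

End FaceSign.

(** * Vanishing by the cone homotopy *)

Section Cone.
Variables (k : fieldType) (n : nat).

(** Every cocycle on [K] is already a coboundary there, and its primitive restricts to [K']. *)
Lemma coh_rank_cone (K K' : {set {set 'I_n}}) (v : 'I_n) d :
  subfamily K' K ->
  (forall F, F \in K -> F :\ v \in K /\ v |: F \in K) ->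
  coh_rank k K K' d 0.
Proof.
move=> sub cone; apply/coh_rankE => //; apply: has_dim0 => w; split; last first.
  move=> ->; exists 0; first exact: (linearfun0 (@coboundary_linear _ _ _ _ _)).
  by rewrite /= (linearfun0 (@transfer_linear _ _ _ _ _))
             (linearfun0 (quotmod_pi_linear _)).
move=> [z z0 ->]; apply/coh_pi_eq0 => /=.
(* The cone homotopy applied to [z]: contraction with the vertex [v]. *)
pose b : chain k K (d - 1) := [ffun F : face K (d - 1) =>
  (if v \notin val F then face_sign k (v |: val F) v * coef z (v |: val F)
   else 0)].
have coef_b F : F \in K -> coef b F =
    if v \notin F then face_sign k (v |: F) v * coef z (v |: F) else 0.
  move=> FK; rewrite (@coef_ffun _ _ _ _ (fun F =>
    if v \notin F then face_sign k (v |: F) v * coef z (v |: F) else 0)) FK /=.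
  case: eqP => // cF; case: ifPn => // vF; rewrite coef_eq0 ?mulr0 //.
  rewrite negb_and cardsU1 vF PoszD; apply/orP; right; apply/eqP => h; apply: cF.
  by rewrite subrK; apply: (addrI 1); rewrite h addrC.
suff -> : z = coboundary d b.
  by exists (transfer K' b); exact: transfer_coboundary.
apply: coefP => G GK _; rewrite coef_coboundary ?subrK // GK.
(* If [G] contains [v], only the term removing [v] survives, since [b] vanishes on sets containing
   [v]. *)
have [vG|vG] := boolP (v \in G).
  rewrite (bigD1 v) //= coef_b ?(cone _ GK).1 // setD11 setD1K // mulrA.
  rewrite face_sign_sqr mul1r big1 ?addr0 // => j /andP[jG jv].
  have [FK|FK] := boolP (G :\ j \in K); last by rewrite coef_notin ?mulr0.
  by rewrite coef_b // !inE eq_sym jv vG /= mulr0.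
(* Otherwise the cocycle condition on [v |: G] expresses the value of [z] at [G] through its values
   at the sets [(v |: G) :\ j]. *)
have [_ vGK] := cone _ GK.
have := coboundary_eq0 (erefl _) z0 vGK.
rewrite (bigD1 v) ?setU11 //= setU1K // => /eqP; rewrite addr_eq0 => /eqP e.
rewrite -[LHS]mul1r -(face_sign_sqr k (v |: G) v) -mulrA e mulrN mulr_sumr -sumrN.
have predE j : (j \in v |: G) && (j != v) = (j \in G).
  rewrite !inE; case: eqP => [->|_]; rewrite ?andbF ?andbT //=.
  by apply/esym/negbTE.
rewrite (eq_bigl _ _ predE); apply: eq_bigr => j jG.
have jv : j != v by apply: contraNneq vG => <-.
have vjE : v |: G :\ j = (v |: G) :\ j.
  by apply/setP => l; rewrite !inE; case: eqP => [->|]; rewrite ?andbF // eq_sym jv.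
(* If [G :\ j] is missing from [K], stability under removing [v] shows that [(v |: G) :\ j] is
   missing too, and both terms are zero. *)
have [FK|FK] := boolP (G :\ j \in K); last first.
  rewrite !coef_notin ?mulr0 ?oppr0 //; apply: contra FK => h.
  have := (cone _ h).1; congr (_ \in K); apply/setP => l; rewrite !inE.
  by case: eqP => [->|_] //=; rewrite (negPf vG) andbF.
rewrite coef_b // !inE (negPf vG) andbF /= vjE !mulrA -mulNr; congr (_ * _).
have -> : face_sign k G j = face_sign k ((v |: G) :\ v) j by rewrite setU1K.
by rewrite face_sign_swap // ?setU11 // !inE jG orbT.
Qed.
End Cone.

(** * Comparison of a link with its translate by [sigma] *)

Section Shift.
Variables (k : fieldType) (n : nat) (sigma : {set 'I_n}).
Implicit Types (L K : {set {set 'I_n}}) (tau F : {set 'I_n}) (d e : int).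

(** That is, union with [sigma] is a bijection from [L] to [K], with inverse [F :\: sigma]. *)
Definition shifted L K : Prop :=
  (forall tau, tau \in L -> [disjoint tau & sigma] /\ tau :|: sigma \in K) /\
  (forall F, F \in K -> sigma \subset F /\ F :\: sigma \in L).

(** The degrees are independent parameters to avoid casts; the lemmas assume [e = d + #|sigma|]. The
    sign makes it a map of complexes. *)
Definition shift L K d e (c : chain k L d) : chain k K e :=
  [ffun F : face K e => shuffle_sign k sigma (val F :\: sigma) *
                          coef c (val F :\: sigma)].

Definition unshift L K d e (c : chain k K e) : chain k L d :=
  [ffun tau : face L d => shuffle_sign k sigma (val tau) *
                            coef c (val tau :|: sigma)].

Lemma shift_linear L K d e : linear (@shift L K d e).
Proof.
move=> a b c; apply/ffunP => F; rewrite !ffunE coef_linear mulrDr.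
by congr (_ + _); rewrite mulrCA.
Qed.

Lemma cardsD_sub F : sigma \subset F -> #|F|%:Z = #|F :\: sigma|%:Z + #|sigma|%:Z.
Proof. by move=> sF; rewrite -PoszD -(cardsID sigma F) (setIidPr sF) addnC. Qed.

Lemma setDUK F : sigma \subset F -> F :\: sigma :|: sigma = F.
Proof. by move=> sF; rewrite setUC -{1}(setIidPr sF) setID. Qed.

Lemma coef_shift L K d e (c : chain k L d) F :
  shifted L K -> e = d + #|sigma|%:Z ->
  coef (shift K e c) F =
    if sigma \subset F then
      shuffle_sign k sigma (F :\: sigma) * coef c (F :\: sigma) else 0.
Proof.
move=> [LK KL] ed; rewrite (@coef_ffun _ _ _ _ (fun F =>
  shuffle_sign k sigma (F :\: sigma) * coef c (F :\: sigma))).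
have [FK|FK] /= := boolP (F \in K); last first.
  case: ifP => // sF; rewrite coef_notin ?mulr0 //; apply: contra FK => h.
  by have [_] := LK _ h; rewrite setDUK.
have [sF _] := KL _ FK; rewrite sF; case: eqP => // cF.
rewrite coef_eq0 ?mulr0 // negb_and; apply/orP; right; apply/eqP => h; apply: cF.
by rewrite cardsD_sub // h ed addrAC.
Qed.

Lemma shift_coboundary L K d e d' e' (c : chain k L d) :
  shifted L K -> e = d + #|sigma|%:Z -> d' = d + 1 -> e' = e + 1 ->
  shift K e' (coboundary d' c) = coboundary e' (shift K e c).
Proof.
move=> LK ed dd ee; have ed' : e' = d' + #|sigma|%:Z by rewrite ee dd ed addrAC.
apply: coefP => F FK _; have [sF FL] := LK.2 _ FK.
rewrite coef_shift // sF !coef_coboundary // FK FL mulr_sumr.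
rewrite [LHS]big_mkcond [RHS]big_mkcond; apply: eq_bigr => j _.
rewrite in_setD coef_shift //; have [jF|jF] := boolP (j \in F); last by rewrite andbF.
(* Removing a vertex of [sigma] leaves a set not containing [sigma], outside [K]; only the vertices
   of [F :\: sigma] contribute. *)
rewrite subsetD1 sF andbT; case: ifPn => js; last by rewrite mulr0.
rewrite !mulrA face_sign_shuffle //; congr (_ * coef _ _).
by apply/setP => l; rewrite !inE andbCA.
Qed.

Lemma shiftK L K d e (c : chain k L d) : shifted L K -> e = d + #|sigma|%:Z ->
  unshift L d (shift K e c) = c.
Proof.
move=> LK ed; apply/ffunP => F; rewrite ffunE.
have /andP[FL _] := valP F; have [dis FK] := LK.1 _ FL.
have FE : (val F :|: sigma) :\: sigma = val F.
  by rewrite setDUl setDv setU0; apply/setDidPl.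
rewrite coef_shift // subsetUr FE mulrA shuffle_sign_sqr mul1r.
exact: coef_val.
Qed.

Lemma unshiftK L K d e (c : chain k K e) : shifted L K -> e = d + #|sigma|%:Z ->
  shift K e (unshift L d c) = c.
Proof.
move=> LK ed; apply: coefP => F FK cF; have [sF FL] := LK.2 _ FK.
rewrite coef_shift // sF (@coef_ffun _ _ _ _ (fun tau =>
  shuffle_sign k sigma tau * coef c (tau :|: sigma))) FL /=.
case: eqP => [_|[]]; first by rewrite setDUK // mulrA shuffle_sign_sqr mul1r.
by apply: (addIr #|sigma|%:Z); rewrite -cardsD_sub // cF ed addrAC.
Qed.

Lemma unshift_coboundary L K d e d' e' (c : chain k K e) :
  shifted L K -> e = d + #|sigma|%:Z -> d' = d + 1 -> e' = e + 1 ->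
  unshift L d' (coboundary e' c) = coboundary d' (unshift L d c).
Proof.
move=> LK ed dd ee; have ed' : e' = d' + #|sigma|%:Z by rewrite ee dd ed addrAC.
rewrite -[RHS](shiftK _ LK ed') (shift_coboundary _ LK ed dd ee).
by rewrite (unshiftK _ LK ed).
Qed.

Lemma shift_transfer L K L' K' d e (c : chain k L d) :
  shifted L K -> shifted L' K' -> subfamily K' K -> e = d + #|sigma|%:Z ->
  transfer K' (shift K e c) = shift K' e (transfer L' c).
Proof.
move=> LK LK' [/subsetP sub _] ed; apply: coefP => F FK _.
have [sF FL] := LK'.2 _ FK.
by rewrite coef_transfer FK !coef_shift // sF coef_transfer FL.
Qed.

Lemma coh_rank_shift L K L' K' d e r :
  shifted L K -> shifted L' K' -> subfamily L' L -> subfamily K' K ->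
  e = d + #|sigma|%:Z -> coh_rank k L L' d r -> coh_rank k K K' e r.
Proof.
move=> LK LK' subL subK ed; rewrite !coh_rankE //.
have ed1 : e + 1 = d + 1 + #|sigma|%:Z by rewrite ed addrAC.
have edB : e - 1 = d - 1 + #|sigma|%:Z by rewrite ed addrAC.
apply: (@has_dim_transport_image _ _ _ _ _ _ _ _ _ (@shift L K d e)).
- by move=> a b c; rewrite /= transfer_linear quotmod_pi_linear.
- by move=> a b c; rewrite /= shift_linear transfer_linear quotmod_pi_linear.
- exact: (linearfun0 (@coboundary_linear _ _ _ _ _)).
- by move=> a z z' z0 z0'; rewrite coboundary_linear z0 z0' scaler0 addr0.
- move=> z z0; rewrite -(shift_coboundary _ LK ed (erefl _) (erefl _)) z0.
  exact: (linearfun0 (@shift_linear _ _ _ _)).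
- move=> z z0; exists (unshift L d z); last by rewrite (unshiftK _ LK ed).
  rewrite -(unshift_coboundary _ LK ed (erefl _) (erefl _)) z0.
  by rewrite -(linearfun0 (@shift_linear L K (d + 1) (e + 1))) (shiftK _ LK ed1).
move=> z _ /=; rewrite !coh_pi_eq0 (shift_transfer _ LK LK' subK ed).
split=> -[b bE].
  exists (shift K' (e - 1) b); rewrite bE.
  by rewrite (shift_coboundary _ LK' edB) ?subrK.
exists (unshift L' (d - 1) b).
rewrite -(unshift_coboundary _ LK' edB (e' := e)) ?subrK // -bE.
by rewrite (shiftK _ LK' ed).
Qed.

End Shift.

(** * Coefficients at integer exponents and the Stanley-Reisner ideal *)

Section MonomialCoefficient.
Variables (k : fieldType) (n : nat).
Local Notation S := {mpoly k[n]}.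
Implicit Types (p : S) (beta : 'I_n -> int) (F tau : {set 'I_n}).

Definition nonneg beta : bool := [forall j, 0 <= beta j].
Definition monom beta : 'X_{1..n} := [multinom `|beta j|%N | j < n].
(** The test guards against [monom], which takes absolute values: a monomial with a negative
    exponent has coefficient zero. *)
Definition zcoef p beta : k := if nonneg beta then p@_(monom beta) else 0.

Lemma nonnegP beta : reflect (forall j, 0 <= beta j) (nonneg beta).
Proof. exact: forallP. Qed.

Lemma eq_zcoef p beta beta' : beta =1 beta' -> zcoef p beta = zcoef p beta'.
Proof.
move=> e; rewrite /zcoef /nonneg (eq_forallb (fun j => congr1 _ (e j))).
by case: ifP => // _; congr (p@__); apply/mnmP => j; rewrite !mnmE e.
Qed.

Lemma zcoefC_MD c p p' beta :
  zcoef (c%:MP_[n] * p + p') beta = c * zcoef p beta + zcoef p' beta.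
Proof.
by rewrite /zcoef; case: ifP => _; rewrite ?mulr0 ?addr0 // mcoeffD mcoeffCM.
Qed.

Lemma zcoefB p p' beta : zcoef (p - p') beta = zcoef p beta - zcoef p' beta.
Proof. by rewrite /zcoef; case: ifP => _; rewrite ?subr0 // mcoeffB. Qed.

Lemma mcoeff_mulX_gt p (m m' : 'X_{1..n}) j :
  (m' j < m j)%N -> (p * 'X_[m])@_m' = 0.
Proof.
move=> h; apply/eqP; rewrite mcoeff_eq0 (perm_mem (msuppMX p m)).
by apply/mapP => -[m0 _ E]; move: h; rewrite E mnmDE ltnNge leq_addr.
Qed.

Lemma zcoef_mulX p beta (m : 'X_{1..n}) :
  zcoef (p * 'X_[m]) (fun j => beta j + (m j)%:Z) = zcoef p beta.
Proof.
rewrite /zcoef; case: (nonnegP beta) => [h|h].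
  have -> : nonneg (fun j => beta j + (m j)%:Z).
    by apply/nonnegP => j; rewrite addr_ge0.
  rewrite -(mcoeffMX p m); congr (_@__); apply/mnmP => j; rewrite mnmDE !mnmE.
  by have := h j; lia.
case: ifP => // /nonnegP h'.
(* At a negative entry [j] of [beta] the shifted exponent is below [m j], so no monomial of the
   product reaches it. *)
have [j hj] : exists j, ~ (0 <= beta j).
  by apply: contra_notP h => /forallNP h j; apply: contrapT.
apply: (@mcoeff_mulX_gt _ _ _ j); rewrite mnmE.
by have := h' j; move: hj; lia.
Qed.

Lemma zcoef_monom beta : nonneg beta -> zcoef ('X_[monom beta] : S) beta = 1.
Proof. by rewrite /zcoef => ->; rewrite mcoeffX eqxx. Qed.

Lemma S_degE beta p :
  S_deg beta p -> p = (zcoef p beta)%:MP * 'X_[monom beta].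
Proof.
move=> degp; apply/mpolyP => m; rewrite mcoeffCM mcoeffX.
have [mp|mp] := boolP (m \in msupp p).
  have mE : monom beta = m.
    by apply/mnmP => j; rewrite mnmE -(degp m mp).
  rewrite mE eqxx mulr1 /zcoef mE; case: (nonnegP beta) => // h; case: h => j.
  by rewrite -(degp m mp).
move: (mp); rewrite -mcoeff_eq0 => /eqP m0; rewrite m0.
case: eqP => [E|_]; last by rewrite mulr0.
by rewrite /zcoef E m0 if_same mul0r.
Qed.

Lemma S_deg_monom beta : nonneg beta -> S_deg beta ('X_[monom beta] : S).
Proof.
move=> /nonnegP h m; rewrite msuppX inE => /eqP-> j; rewrite mnmE.
by have := h j; lia.
Qed.

Definition setm F : 'X_{1..n} := [multinom (j \in F : nat) | j < n].

Lemma xprodE F : xprod (@var k n) F = 'X_[setm F].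
Proof.
rewrite mpolyXE_id /xprod big_mkcond; apply: eq_bigr => j _.
by rewrite mnmE; case: (j \in F); rewrite ?expr1 ?expr0.
Qed.

Lemma xprod_expE F a : xprod (@var k n) F ^+ a = 'X_[setm F *+ a].
Proof. by rewrite xprodE mpolyXn. Qed.

Section Ideal.
Variable Gamma : {set {set 'I_n}}.
Hypothesis hGamma : simplicial_complex Gamma.

Lemma SR_idealP p :
  reflect (exists c : {set 'I_n} -> S,
    p = \sum_(tau : {set 'I_n} | tau \notin Gamma) c tau * \prod_(j in tau) 'X_j)
    (p \in SR_ideal Gamma).
Proof. exact: asboolP. Qed.

Lemma monom_SR_ideal p (m : 'X_{1..n}) tau :
  tau \notin Gamma -> (forall j, j \in tau -> (0 < m j)%N) ->
  p * 'X_[m] \in SR_ideal Gamma.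
Proof.
move=> ntau h.
have -> : m = (m - setm tau + setm tau)%MM.
  apply/mnmP => j; rewrite mnmDE mnmBE mnmE; have := h j.
  by case: (j \in tau) => [/(_ isT)|_] /=; lia.
rewrite mpolyXD mulrA; apply/SR_idealP.
exists (fun tau' => if tau' == tau then p * 'X_[m - setm tau] else 0).
rewrite (bigD1 tau) //= eqxx [X in _ + X]big1 => [|tau' /andP[_ /negPf->]].
  by rewrite addr0 -xprodE.
by rewrite mul0r.
Qed.

(** The monomial of a nonface cannot divide a monomial whose support is a face, as faces are closed
    under subsets. *)
Lemma zcoef_ideal p beta :
  p \in SR_ideal Gamma -> [set j | 0 < beta j] \in Gamma -> zcoef p beta = 0.
Proof.
move=> /SR_idealP[c ->] bG; rewrite /zcoef; case: nonnegP => // h.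
rewrite raddf_sum big1 // => tau ntau /=.
have /subsetPn[j jt jb] : ~~ (tau \subset [set j | 0 < beta j]).
  by apply: contra ntau; exact: hGamma.
rewrite -[\prod_(j in tau) _]/(xprod (@var k n) tau) xprodE.
apply: (@mcoeff_mulX_gt _ _ _ j); rewrite !mnmE jt.
by move: jb; rewrite inE; have := h j; lia.
Qed.

End Ideal.
End MonomialCoefficient.

(** * Functoriality of localization and of the Cech complex *)

Section LocFun.
Variables (A : comNzRingType) (M M' : lmodType A) (phi : M -> M').
Hypothesis lin : linear phi.

Lemma loc_funE u m a : loc_fun phi (frac u m a) = frac u (phi m) a.
Proof.
have [c e] := loc_repr u m a; apply/fracE; exists c.
by rewrite -!(linearfunZ lin) e.
Qed.

Lemma loc_fun_linear u : linear (@loc_fun _ _ _ u phi).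
Proof.
move=> b x y; rewrite -[x]fracK -[y]fracK.
move: (loc_num x) (loc_den x) (loc_num y) (loc_den y) => m a m' a'.
rewrite [b *: _]loc_scaleE [_ + _ in LHS]loc_addE !loc_funE.
rewrite [b *: _ in RHS]loc_scaleE [_ + _ in RHS]loc_addE.
by rewrite lin !(linearfunZ lin) -(linearfunZ lin).
Qed.

Lemma loc_fun_map u v w (x : loc M u) : v = w * u ->
  loc_fun phi (loc_map v w x) = loc_map v w (loc_fun phi x) :> loc M' v.
Proof.
move=> vE; rewrite -[x]fracK (loc_mapE vE) !loc_funE (loc_mapE vE).
by rewrite (linearfunZ lin).
Qed.

Variables (n : nat) (x : 'I_n -> A) (J : {set 'I_n}).

Lemma xprodD1 (G : {set 'I_n}) j : j \in G -> xprod x G = x j * xprod x (G :\ j).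
Proof. by move=> jG; rewrite /xprod (big_setD1 j). Qed.

Lemma cech_fun_linear q : linear (@cech_fun _ _ x J _ _ phi q).
Proof.
move=> a b c; apply: mp_ext => F.
rewrite [mp_at (_ + _) _]mp_mkE [mp_at (_ *: _) _]mp_mkE !mp_mkE.
exact: loc_fun_linear.
Qed.

Lemma cech_fun_diff p q (c : cech x J M p) :
  cech_fun phi (cech_diff q c) = cech_diff q (cech_fun phi c).
Proof.
apply: mp_ext => G; rewrite !mp_mkE (linearfun_sum (@loc_fun_linear _)).
apply: eq_bigr => j jG; rewrite (linearfunZ (@loc_fun_linear _)); congr (_ *: _).
case: insubP => [F _ FE|_] /=; last exact: (linearfun0 (@loc_fun_linear _)).
by rewrite mp_mkE loc_fun_map // FE; exact: xprodD1.
Qed.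

Lemma cech_bound0P (c : cech x J M 0) :
  reflect (c = 0) (c \in @cech_bound _ _ x J M 0).
Proof. exact: eqP. Qed.

Lemma cech_boundP q (c : cech x J M q.+1) :
  reflect (exists b : cech x J M q, c = cech_diff q.+1 b)
    (c \in @cech_bound _ _ x J M q.+1).
Proof. exact: asboolP. Qed.

End LocFun.

(** * Induced maps on Cech cohomology, computed on cocycles *)

Section LcohMap.
Variables (A : comNzRingType) (M M' : lmodType A) (phi : M -> M').
Hypothesis lin : linear phi.
Variables (n : nat) (x : 'I_n -> A) (J : {set 'I_n}).

Lemma cech_bound_fun q (c : cech x J M q) :
  c \in @cech_bound _ _ x J M q -> cech_fun phi c \in @cech_bound _ _ x J M' q.
Proof.
case: q c => [|q] c.
  move=> /cech_bound0P->; apply/cech_bound0P.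
  exact: (linearfun0 (@cech_fun_linear _ _ _ _ lin _ _ _ _)).
move=> /cech_boundP[b ->]; apply/cech_boundP; exists (cech_fun phi b).
exact: cech_fun_diff.
Qed.

Lemma lcoh_map_pi q (c : cech x J M q) :
  lcoh_map phi (quotmod_pi (@cech_bound _ _ x J M q) c) =
  quotmod_pi (@cech_bound _ _ x J M' q) (cech_fun phi c).
Proof.
apply: quotmod_map_pi; first exact: cech_fun_linear.
exact: cech_bound_fun.
Qed.

Lemma cech_fun_pi_linear q :
  linear (fun z : cech x J M q =>
    quotmod_pi (@cech_bound _ _ x J M' q) (cech_fun phi z)).
Proof. by move=> a b c; rewrite cech_fun_linear // quotmod_pi_linear. Qed.

Lemma lcoh_map_image q (P : cech x J M q -> Prop) w :
  image_of (lcoh_map phi (q := q)) (lcoh_classes P) w <->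
  image_of (fun z => quotmod_pi (@cech_bound _ _ x J M' q) (cech_fun phi z))
    (fun z => cech_diff q.+1 z = 0 /\ P z) w.
Proof.
split=> [[_ [z Pz ->] ->]|[z Pz ->]].
  by exists z => //; exact: lcoh_map_pi.
exists (quotmod_pi (@cech_bound _ _ x J M q) z); first by exists z.
exact/esym/lcoh_map_pi.
Qed.

End LcohMap.

(** * The surjection between Stanley-Reisner rings *)

Section StanleyReisnerMap.
Variables (k : fieldType) (n : nat).
Local Notation S := {mpoly k[n]}.
Variables Gamma Gamma' : {set {set 'I_n}}.
Hypothesis sub : Gamma' \subset Gamma.

Lemma SR_ideal_subset (p : S^o) :
  p \in SR_ideal Gamma -> p \in SR_ideal Gamma'.
Proof.
move=> /SR_idealP[c ->]; apply/SR_idealP.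
exists (fun tau => if tau \notin Gamma then c tau else 0).
rewrite big_mkcond [RHS]big_mkcond; apply: eq_bigr => tau _.
case: ifPn => [h|h]; last by case: ifP; rewrite ?mul0r.
by rewrite ifT //; apply: contra h; exact: (subsetP sub).
Qed.

Lemma SR_map_pi (p : S^o) :
  @SR_map k n Gamma Gamma' (quotmod_pi (SR_ideal Gamma) p) =
  quotmod_pi (SR_ideal Gamma') p.
Proof. by apply: quotmod_map_pi => //; exact: SR_ideal_subset. Qed.

Lemma SR_map_linear : linear (@SR_map k n Gamma Gamma').
Proof.
move=> a u v; rewrite -[u]quotmod_reprK -[v]quotmod_reprK.
by rewrite -quotmod_pi_linear !SR_map_pi quotmod_pi_linear.
Qed.

End StanleyReisnerMap.

(** * Graded pieces of the localized Stanley-Reisner rings *)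

Section LaurentCoefficient.
Variables (k : fieldType) (n : nat) (alpha : 'I_n -> int).
Local Notation S := {mpoly k[n]}.
Local Notation xF F := (xprod (@var k n) F).
Implicit Types (F G : {set 'I_n}) (p : S).

(** The degree of a numerator over [x_F ^ a] when the fraction has degree [alpha], as in
    [loc_deg]. *)
Definition ldeg F (a : nat) : 'I_n -> int :=
  fun j => alpha j + (if j \in F then a%:Z else 0).

Definition pos : {set 'I_n} := [set j | 0 < alpha j].
Definition neg : {set 'I_n} := [set j | alpha j < 0].

Lemma zcoef_xprod F a c p :
  zcoef (xF F ^+ c * p) (ldeg F (c + a)) = zcoef p (ldeg F a).
Proof.
rewrite xprod_expE mulrC -(zcoef_mulX p (ldeg F a) (setm F *+ c)%MM).
apply: eq_zcoef => j; rewrite /ldeg mulmnE mnmE.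
by case: (j \in F); lia.
Qed.

Lemma zcoef_var G j a p : j \in G ->
  zcoef ('X_j ^+ a * p) (ldeg G a) = zcoef p (ldeg (G :\ j) a).
Proof.
move=> jG; rewrite mpolyXn mulrC -(zcoef_mulX p (ldeg (G :\ j) a) (U_(j) *+ a)%MM).
apply: eq_zcoef => l; rewrite /ldeg mulmnE mnm1E !inE eq_sym.
by case: eqP => [<-|_]; rewrite ?jG /= ?mul1n ?mul0n !addr0 //.
Qed.

Lemma pos_ldeg F a : [set j | 0 < ldeg F a j] \subset F :|: pos.
Proof.
apply/subsetP => j; rewrite !inE /ldeg; case: (j \in F) => //=.
by rewrite addr0.
Qed.

Lemma nonneg_ldeg_sub F a : nonneg (ldeg F a) -> neg \subset F.
Proof.
move=> /nonnegP h; apply/subsetP => j; rewrite inE; have := h j; rewrite /ldeg.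
by case: (j \in F) => //=; lia.
Qed.

(** A power of x_F large enough to clear the denominators of x^alpha, chosen uniformly in [F]. *)
Definition laurent_den : nat := \sum_(j < n) `|alpha j|%N.

Lemma nonneg_ldeg_laurent_den F : neg \subset F -> nonneg (ldeg F laurent_den).
Proof.
move=> /subsetP nF; apply/nonnegP => j; rewrite /ldeg; have := nF j; rewrite inE.
have : (`|alpha j| <= laurent_den)%N by rewrite /laurent_den (bigD1 j) //= leq_addr.
by case: (j \in F); case: ltP => h1 h2 h3; have := h3; lia.
Qed.

Section Ring.
Variable Gamma : {set {set 'I_n}}.
Hypothesis hGamma : simplicial_complex Gamma.
Local Notation I := (SR_ideal Gamma : submodClosed (S^o : lmodType S)).
Local Notation pi p := (quotmod_pi (SR_ideal Gamma) (p : S^o) : SR k Gamma).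

Lemma SR_piZ (a p : S) : a *: pi p = pi (a * p).
Proof. exact: quotmod_scale_pi. Qed.

Lemma SR_piD (p p' : S) : pi p + pi p' = pi (p + p').
Proof. exact/esym/quotmod_piD. Qed.

Lemma locP u (y : loc (SR k Gamma) u) : exists p a, y = frac u (pi p) a.
Proof.
exists (quotmod_repr (loc_num y)), (loc_den y).
by rewrite quotmod_reprK fracK.
Qed.

(* The coefficient of x^alpha in an element of k[Gamma]_(x_F); meaningful when
   F together with [pos] is a face. *)
Definition kappa F (y : loc (SR k Gamma) (xF F)) : k :=
  zcoef (quotmod_repr (loc_num y)) (ldeg F (loc_den y)).

(** Two numerators of one fraction agree, after multiplication by powers of x_F, up to an element of
    the ideal. The exponent in question is supported in the face [F :|: pos], where elements of the
    ideal have coefficient zero. *)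
Lemma kappaE F p a :
  F :|: pos \in Gamma -> kappa (frac (xF F) (pi p) a) = zcoef p (ldeg F a).
Proof.
move=> FG; rewrite /kappa; have [c] := loc_repr (xF F) (pi p) a.
move: (loc_num _) (loc_den _) => m b.
rewrite -{1}[m]quotmod_reprK; move: (quotmod_repr m) => r.
rewrite !SR_piZ => /quotmod_piE h.
have sG : [set j | 0 < ldeg F (c + a + b) j] \in Gamma.
  exact: hGamma FG (pos_ldeg _ _).
have := zcoef_ideal hGamma h sG; rewrite zcoefB => /eqP; rewrite subr_eq0.
rewrite zcoef_xprod addnAC zcoef_xprod => /eqP; exact.
Qed.

(** No power of x_F absorbs a negative exponent outside [F], so [zcoef] takes its default value. *)
Lemma kappa_eq0 F y : ~~ (neg \subset F) -> @kappa F y = 0.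
Proof. by rewrite /kappa /zcoef; case: ifP => // /nonneg_ldeg_sub->. Qed.

Lemma kappa_linear F (c : k) x y : F :|: pos \in Gamma ->
  @kappa F (c%:MP_[n] *: x + y) = c * kappa x + kappa y.
Proof.
move=> FG; have [p [a ->]] := locP x; have [p' [a' ->]] := locP y.
rewrite [_ *: _]loc_scaleE SR_piZ [_ + _ in LHS]loc_addE.
rewrite !SR_piZ SR_piD !kappaE // mulrCA.
by rewrite zcoefC_MD zcoef_xprod [(a + a')%N]addnC zcoef_xprod.
Qed.

Lemma kappa0 F : F :|: pos \in Gamma -> @kappa F 0 = 0.
Proof.
move=> FG; have := @kappa_linear F (-1) 0 0 FG.
by rewrite scaler0 addr0 mulN1r addNr.
Qed.

Lemma kappaZ F (c : k) x : F :|: pos \in Gamma ->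
  @kappa F (c%:MP_[n] *: x) = c * kappa x.
Proof.
by move=> FG; have := kappa_linear c x 0 FG; rewrite kappa0 // !addr0.
Qed.

Lemma kappa_sum F (I : Type) (r : seq I) (P : pred I) (c : I -> k) y :
  F :|: pos \in Gamma ->
  @kappa F (\sum_(l <- r | P l) (c l)%:MP_[n] *: y l) =
  \sum_(l <- r | P l) c l * kappa (y l).
Proof.
move=> FG; elim/big_rec2: _ => [|l a b Pl <-]; first exact: kappa0.
exact: kappa_linear.
Qed.

Lemma kappa_map G j F (y : loc (SR k Gamma) (xF F)) :
  j \in G -> F = G :\ j -> G :|: pos \in Gamma ->
  kappa (loc_map (xF G) (var k j) y : loc (SR k Gamma) (xF G)) = kappa y.
Proof.
move=> jG FE GG; subst F; have [p [a ->]] := locP y.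
rewrite loc_mapE; last exact: xprodD1.
rewrite SR_piZ !kappaE //; first exact: zcoef_var.
by apply: hGamma GG _; rewrite setSU // subD1set.
Qed.

(* x^alpha as a fraction; meaningful when [neg] is contained in F, since [monom]
   takes absolute values of the exponents. *)
Definition laurent F : loc (SR k Gamma) (xF F) :=
  frac (xF F) (pi 'X_[monom (ldeg F laurent_den)]) laurent_den.

Lemma kappa_laurent F :
  neg \subset F -> F :|: pos \in Gamma -> kappa (laurent F) = 1.
Proof.
by move=> nF FG; rewrite kappaE // zcoef_monom // nonneg_ldeg_laurent_den.
Qed.

Lemma frac_monom F a b : nonneg (ldeg F a) -> nonneg (ldeg F b) ->
  frac (xF F) (pi 'X_[monom (ldeg F a)]) a =
  frac (xF F) (pi 'X_[monom (ldeg F b)]) b.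
Proof.
move=> /nonnegP ha /nonnegP hb; apply/fracE; exists 0%N; rewrite !add0n.
rewrite !SR_piZ; congr (quotmod_pi _ _).
rewrite !xprod_expE -!mpolyXD; congr 'X_[_].
apply/mnmP => j; rewrite !mnmDE !mulmnE !mnmE.
by have := ha j; have := hb j; rewrite /ldeg; case: (j \in F) => /=; lia.
Qed.

Lemma laurent_eq0 F : neg \subset F -> F :|: pos \notin Gamma -> laurent F = 0.
Proof.
(* One extra factor x_F makes every variable of [F] occur in the numerator, even where its exponent
   was zero; the support then contains the nonface [F :|: pos]. *)
move=> nF FG; apply/fracE; exists 1%N; rewrite scaler0 SR_piZ.
apply/quotmod_pi_eq0; rewrite xprod_expE -mpolyXD -['X_[_]]mul1r.
apply: monom_SR_ideal FG _ => j.
rewrite mnmDE mulmnE !mnmE /ldeg !inE; case: (j \in F) => //=.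
by rewrite addr0; lia.
Qed.

Lemma loc_degE F (y : loc (SR k Gamma) (xF F)) : loc_deg alpha y ->
  y = if (neg \subset F) && (F :|: pos \in Gamma)
      then (kappa y)%:MP_[n] *: laurent F else 0.
Proof.
move=> [_ [a [[p degp ->] ->]]].
have -> : frac (xF F) (pi p) a =
    (zcoef p (ldeg F a))%:MP_[n] *: frac (xF F) (pi 'X_[monom (ldeg F a)]) a.
  by rewrite [_ *: _]loc_scaleE SR_piZ -(S_degE degp).
(* With a negative exponent in the numerator degree, the numerator and hence the fraction is
   zero. *)
have [nn|nn] := boolP (nonneg (ldeg F a)); last first.
  rewrite /zcoef (negPf nn) scale0r; case: ifP => // /andP[_ FG].
  by rewrite kappa0 // scale0r.
have nF := nonneg_ldeg_sub nn.
rewrite (frac_monom nn (nonneg_ldeg_laurent_den nF)) -/(laurent F) nF /=.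
case: ifPn => FG; last by rewrite laurent_eq0 // scaler0.
move: (zcoef _ _) => c.
have e : kappa (c%:MP_[n] *: laurent F) = c.
  rewrite (kappaZ c (laurent F) FG).
  by rewrite (kappa_laurent nF FG) mulr1.
by rewrite e.
Qed.

Lemma loc_deg_laurent F (c : k) :
  neg \subset F -> loc_deg alpha (c%:MP_[n] *: laurent F).
Proof.
move=> nF.
exists (pi (c%:MP_[n] * 'X_[monom (ldeg F laurent_den)])), laurent_den; split.
  exists (c%:MP_[n] * 'X_[monom (ldeg F laurent_den)] : S) => //.
  move=> m; rewrite mul_mpolyC => /msuppZ_le.
  exact: S_deg_monom (nonneg_ldeg_laurent_den nF) _.
by rewrite [LHS]loc_scaleE SR_piZ.
Qed.

Lemma loc_deg0 F : loc_deg alpha (0 : loc (SR k Gamma) (xF F)).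
Proof.
exists 0, 0%N; split=> //; exists 0; first by move=> m; rewrite msupp0.
exact/esym/linearfun0/quotmod_pi_linear.
Qed.

Lemma loc_map_laurent G j : j \in G -> neg \subset G :\ j ->
  loc_map (xF G) (var k j) (laurent (G :\ j)) = laurent G.
Proof.
move=> jG nG; rewrite loc_mapE; last exact: xprodD1.
rewrite /laurent SR_piZ; congr (frac _ (pi _) _).
rewrite /var mpolyXn -mpolyXD; congr 'X_[_]; apply/mnmP => l.
have /nonnegP/(_ l) := nonneg_ldeg_laurent_den nG.
rewrite mnmDE mulmnE mnm1E !mnmE /ldeg !inE eq_sym.
by case: eqP => [<-|_] /=; rewrite ?jG /=; last case: (l \in G); lia.
Qed.

End Ring.
End LaurentCoefficient.

(** * Cech cochains given by a coefficient and a generator for each set *)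

Section CechFamily.
Variables (A : comNzRingType) (n : nat) (x : 'I_n -> A) (J : {set 'I_n}).
Variables (M : lmodType A).
Implicit Types (F G : {set 'I_n}) (a : {set 'I_n} -> A).
Implicit Type e : forall F : {set 'I_n}, loc M (xprod x F).

(** Indexing [e] and [a] by all sets lets them be evaluated at [G :\ j] without a proof that it is
    an index. *)
Definition cech_mk p e a : cech x J M p :=
  mp_mk (fun F : cech_index J p => a (val F) *: e (val F)).

Lemma cech_mkP p (c : cech x J M p) e a :
  (forall F : cech_index J p, mp_at c F = a (val F) *: e (val F)) ->
  c = cech_mk p e a.
Proof. by move=> h; apply: mp_ext => F; rewrite mp_mkE. Qed.

Lemma cech_mkE p e a (F : cech_index J p) :
  mp_at (cech_mk p e a) F = a (val F) *: e (val F).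
Proof. exact: mp_mkE. Qed.

Lemma cech_mk_linear p e b a a' :
  cech_mk p e (fun F => b * a F + a' F) = b *: cech_mk p e a + cech_mk p e a'.
Proof.
apply: mp_ext => F; rewrite [RHS]mp_mkE [mp_at (_ *: _) _]mp_mkE !cech_mkE.
by rewrite scalerDl scalerA.
Qed.

(** Hence the default value 0 in [cech_diff] never occurs between consecutive degrees. *)
Lemma cech_index_setD1 p (G : cech_index J p.+1) j : j \in val G ->
  exists2 F : cech_index J p, val F = val G :\ j & insub (val G :\ j) = Some F.
Proof.
move=> jG; have /andP[GJ /eqP cG] := valP G.
have FP : (val G :\ j \subset J) && (#|val G :\ j| == p).
  rewrite (subset_trans (subD1set _ _)) //=.
  by move: cG; rewrite (cardsD1 j) jG add1n => /eqP; rewrite eqSS.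
by exists (Sub (val G :\ j) FP) => //; rewrite insubT.
Qed.

Lemma cech_diff_mk p e a a' :
  (forall G, G \subset J ->
    \sum_(j in G) face_sign A G j *:
       (a (G :\ j) *: loc_map (xprod x G) (x j) (e (G :\ j))) = a' G *: e G) ->
  cech_diff p.+1 (cech_mk p e a) = cech_mk p.+1 e a'.
Proof.
move=> h; apply: cech_mkP => G; rewrite mp_mkE.
have /andP[GJ _] := valP G; rewrite -h //; apply: eq_bigr => j jG.
have [F FE ->] := cech_index_setD1 jG; rewrite [oapp _ _ _]/= cech_mkE.
(* The type of [e F0] depends on [F0], so the equation is substituted for a variable. *)
have mapZ F0 : F0 = val G :\ j ->
    loc_map (xprod x (val G)) (x j) (a F0 *: e F0) =
    a (val G :\ j) *: loc_map (xprod x (val G)) (x j) (e (val G :\ j)).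
  by move=> ->; apply: linearfunZ; apply: loc_map_linear; exact: xprodD1.
congr (_ *: _); exact: mapZ.
Qed.

Lemma cech_diff_at p (c : cech x J M p) (G : cech_index J p.+1) (s : 'I_n -> A) :
  (forall j, face_sign A (val G) j = s j) ->
  mp_at (cech_diff p.+1 c) G = \sum_(j in val G) s j *:
      oapp (fun F : cech_index J p =>
              loc_map (xprod x (val G)) (x j) (mp_at c F)) 0 (insub (val G :\ j)).
Proof. by move=> h; rewrite mp_mkE; apply: eq_bigr => j _; rewrite h. Qed.

End CechFamily.

Lemma cech_fun_mk (A : comNzRingType) (n : nat) (x : 'I_n -> A) (J : {set 'I_n})
    (M M' : lmodType A) (phi : M -> M') p
    (e : forall F : {set 'I_n}, loc M (xprod x F))
    (e' : forall F : {set 'I_n}, loc M' (xprod x F)) a a' :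
  linear phi ->
  (forall F : {set 'I_n}, F \subset J ->
    a F *: loc_fun phi (e F) = a' F *: e' F) ->
  cech_fun phi (cech_mk J p e a) = cech_mk J p e' a'.
Proof.
move=> lin h; apply: cech_mkP => F; have /andP[FJ _] := valP F.
rewrite mp_mkE cech_mkE -h //; apply: linearfunZ; exact: loc_fun_linear.
Qed.

(** * The degree alpha Cech complex as cochains on cells *)

Section CechCells.
Variables (k : fieldType) (n : nat) (alpha : 'I_n -> int) (J : {set 'I_n}).
Local Notation S := {mpoly k[n]}.
Local Notation xF F := (xprod (@var k n) F).
Local Notation pos := (pos alpha).
Local Notation neg := (neg alpha).
Implicit Types (F G : {set 'I_n}) (Gamma : {set {set 'I_n}}) (d e : int).

(* The subsets F of J for which k[Gamma]_(x_F) is nonzero, and then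
   one-dimensional, in degree alpha; [chain k (cells Gamma)] is, up to a shift
   by one, the degree alpha part of the Cech complex. *)
Definition cells Gamma : {set {set 'I_n}} :=
  [set F : {set 'I_n} | [&& F \subset J, neg \subset F & F :|: pos \in Gamma]].

Lemma cellsP Gamma F :
  reflect [/\ F \subset J, neg \subset F & F :|: pos \in Gamma]
          (F \in cells Gamma).
Proof. by rewrite inE; exact: and3P. Qed.

Lemma cells_subfamily Gamma Gamma' :
  simplicial_complex Gamma' -> Gamma' \subset Gamma ->
  subfamily (cells Gamma') (cells Gamma).
Proof.
move=> hG' /subsetP sub; split.
  by apply/subsetP => F /cellsP[? ? /sub ?]; apply/cellsP.
move=> F j /cellsP[_ _ FG] /cellsP[? ? _]; apply/cellsP; split=> //.
by apply: hG' FG _; rewrite setSU // subD1set.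
Qed.

(** For [p = d + 1] this is inverse to [chain_of] on cochains of degree alpha: a set of dimension
    [d] has [p] elements. *)
Definition cech_of Gamma d p (c : chain k (cells Gamma) d) :
    cech (@var k n) J (SR k Gamma) p :=
  cech_mk J p (laurent k alpha Gamma) (fun F => (coef c F)%:MP_[n]).

Definition chain_of Gamma d p (c : cech (@var k n) J (SR k Gamma) p) :
    chain k (cells Gamma) d :=
  [ffun F : face (cells Gamma) d =>
     oapp (fun G : cech_index J p => kappa alpha (mp_at c G)) 0 (insub (val F))].

Lemma coef_chain_of Gamma d p (c : cech (@var k n) J (SR k Gamma) p)
    (G : cech_index J p) : p%:Z = d + 1 -> val G \in cells Gamma ->
  coef (chain_of d c) (val G) = kappa alpha (mp_at c G).
Proof.
move=> pd GK; have cG : #|val G|%:Z == d + 1.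
  by have /andP[_ /eqP->] := valP G; rewrite pd.
have GP : (val G \in cells Gamma) && (#|val G|%:Z == d + 1) by rewrite GK.
rewrite -[val G]/(val (Sub (val G) GP : face (cells Gamma) d)) coef_val.
by rewrite ffunE /= valK.
Qed.

Lemma card_cells Gamma d p F : p%:Z = d + 1 -> F \in cells Gamma ->
  #|F|%:Z = d + 1 -> exists G : cech_index J p, F = val G.
Proof.
move=> pd /cellsP[FJ _ _] cF.
have FP : (F \subset J) && (#|F| == p).
  by rewrite FJ /=; apply/eqP; have := cF; rewrite -pd => -[].
by exists (Sub F FP).
Qed.

Lemma cech_of_linear Gamma d p a (b c : chain k (cells Gamma) d) :
  cech_of p (a *: b + c) = a%:MP_[n] *: cech_of p b + cech_of p c.
Proof.
rewrite -[RHS]cech_mk_linear; congr cech_mk; apply/funext => F.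
by rewrite coef_linear mpolyCD mpolyCM.
Qed.

Lemma cech_of0 Gamma d p : cech_of p (0 : chain k (cells Gamma) d) = 0.
Proof.
have := cech_of_linear p (-1) (0 : chain k (cells Gamma) d) 0.
by rewrite scaler0 addr0 mpolyCN mpolyC1 scaleN1r addNr.
Qed.

Section Complex.
Variable Gamma : {set {set 'I_n}}.
Hypothesis hGamma : simplicial_complex Gamma.

Lemma loc_deg_coef d (c : chain k (cells Gamma) d) F :
  loc_deg alpha ((coef c F)%:MP_[n] *: laurent k alpha Gamma F).
Proof.
have [/cellsP[_ nF _]|FK] := boolP (F \in cells Gamma).
  exact: loc_deg_laurent.
by rewrite coef_notin // scale0r; exact: loc_deg0.
Qed.

Lemma cech_of_deg d p (c : chain k (cells Gamma) d) :
  cech_deg alpha (cech_of p c).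
Proof. by move=> F; rewrite cech_mkE; exact: loc_deg_coef. Qed.

Lemma kappa_coef d (c : chain k (cells Gamma) d) F : F \in cells Gamma ->
  kappa alpha ((coef c F)%:MP_[n] *: laurent k alpha Gamma F) = coef c F.
Proof.
move=> /cellsP[_ nF FG].
by rewrite (kappaZ hGamma _ _ FG) (kappa_laurent k hGamma nF FG) mulr1.
Qed.

Lemma cech_ofK d p (c : chain k (cells Gamma) d) : p%:Z = d + 1 ->
  chain_of d (cech_of p c) = c.
Proof.
move=> pd; apply: coefP => F FK cF; have [G E] := card_cells pd FK cF; subst F.
by rewrite coef_chain_of // cech_mkE; exact: kappa_coef.
Qed.

Lemma chain_of0 d p : p%:Z = d + 1 ->
  chain_of d (0 : cech (@var k n) J (SR k Gamma) p) = 0.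
Proof. by move=> pd; rewrite -(cech_of0 Gamma d) cech_ofK. Qed.

Lemma chain_ofK d p (c : cech (@var k n) J (SR k Gamma) p) : p%:Z = d + 1 ->
  cech_deg alpha c -> cech_of p (chain_of d c) = c.
Proof.
move=> pd degc; apply/esym/cech_mkP => G.
have := loc_degE hGamma (degc G).
have [GK|GK] := boolP (val G \in cells Gamma).
  rewrite (coef_chain_of c pd GK).
  by have /cellsP[_ -> ->] := GK.
rewrite coef_notin // scale0r.
case: ifP => // /andP[nG GG] _; case/negP: GK; apply/cellsP; split=> //.
by have /andP[] := valP G.
Qed.

Lemma face_signC G j : face_sign S G j = (face_sign k G j)%:MP_[n].
Proof. by rewrite /face_sign rmorphXn rmorphN rmorph1. Qed.

Lemma chain_of_diff d e p (c : cech (@var k n) J (SR k Gamma) p) :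
  p%:Z = d + 1 -> e = d + 1 ->
  chain_of e (cech_diff p.+1 c) = coboundary e (chain_of d c).
Proof.
move=> pd ed; have pe : p.+1%:Z = e + 1 by rewrite -addn1 PoszD pd ed.
apply: coefP => F FK cF; rewrite coef_coboundary // FK.
have [G E] := card_cells pe FK cF; subst F.
have /cellsP[GJ nG GG] := FK.
rewrite (coef_chain_of _ pe FK) (cech_diff_at c (face_signC (val G))).
rewrite (kappa_sum hGamma _ _ _ _ GG); apply: eq_bigr => j jG; congr (_ * _).
have [F FE ->] := cech_index_setD1 jG.
rewrite [LHS](kappa_map hGamma (mp_at c F) jG FE GG) -FE.
have [FK'|FK'] := boolP (val F \in cells Gamma).
  by rewrite (coef_chain_of c pd FK').
(* The other two conditions on a cell pass from [G] to its subset, so a facet that is not a cell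
   fails to contain [neg]. *)
rewrite coef_notin //; apply: kappa_eq0; apply: contra FK' => nF.
apply/cellsP; have /andP[FJ _] := valP F; split=> //.
by apply: hGamma GG _; rewrite FE setSU // subD1set.
Qed.

Lemma cech_of_coboundary d e p (c : chain k (cells Gamma) d) :
  p%:Z = d + 1 -> e = d + 1 ->
  cech_of p.+1 (coboundary e c) = cech_diff p.+1 (cech_of p c).
Proof.
move=> pd ed; apply/esym/cech_diff_mk => G GJ.
transitivity ((\sum_(j in G) face_sign k G j * coef c (G :\ j))%:MP_[n] *:
    laurent k alpha Gamma G).
  rewrite rmorph_sum scaler_suml; apply: eq_bigr => j jG.
  rewrite rmorphM -scalerA face_signC; congr (_ *: _).
  have [/cellsP[_ nF _]|FK] := boolP (G :\ j \in cells Gamma).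
    by rewrite loc_map_laurent.
  by rewrite coef_notin // !scale0r.
rewrite (coef_coboundary c G ed); case: ifPn => [//|GK].
rewrite [in RHS]mpolyC0 [RHS]scale0r.
(* For [G] not a cell both sides are zero: either x^alpha vanishes in the localization, or [G]
   misses part of [neg] and so does each of its facets. *)
have [nG|nG] := boolP (neg \subset G).
  have GG : G :|: pos \notin Gamma by apply: contra GK => GG; apply/cellsP.
  by rewrite (laurent_eq0 k nG GG) scaler0.
rewrite big1 ?mpolyC0 ?scale0r // => j _; rewrite coef_notin ?mulr0 //.
apply: contra nG => /cellsP[_ nF _]; exact: subset_trans nF (subD1set _ _).
Qed.

End Complex.

(** The surjection sends x^alpha to x^alpha, which is zero over [Gamma'] exactly at the cells that
    are lost. *)
Lemma cech_of_transfer Gamma Gamma' d p (c : chain k (cells Gamma) d) :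
  simplicial_complex Gamma' -> Gamma' \subset Gamma ->
  cech_fun (@SR_map k n Gamma Gamma') (cech_of p c) =
  cech_of p (transfer (cells Gamma') c).
Proof.
move=> hG' sub; apply: cech_fun_mk => [|F FJ]; first exact: SR_map_linear.
have -> : loc_fun (@SR_map k n Gamma Gamma') (laurent k alpha Gamma F) =
    laurent k alpha Gamma' F.
  by rewrite /laurent loc_funE ?SR_map_pi //; exact: SR_map_linear.
rewrite coef_transfer; case: ifPn => [//|FK'].
rewrite [in RHS]mpolyC0 [RHS]scale0r.
have [/cellsP[_ nF _]|FK] := boolP (F \in cells Gamma); last first.
  by rewrite (coef_notin _ FK) mpolyC0 scale0r.
have FG : F :|: pos \notin Gamma' by apply: contra FK' => FG; apply/cellsP.
by rewrite (laurent_eq0 k nF FG) scaler0.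
Qed.

Lemma cech_of_bound Gamma d q (c : chain k (cells Gamma) d) :
  simplicial_complex Gamma -> d = q%:Z - 1 ->
  cech_of q c \in @cech_bound _ _ (@var k n) J (SR k Gamma) q <->
  c \in @coh_bound k n (cells Gamma) d.
Proof.
move=> hG; case: q => [|q] dq.
  (* For [q = 0] the primitives live in dimension -2, where there are no cells. This matches the
     convention that [cech_bound] is zero in degree 0. *)
  have -> : c \in @coh_bound k n (cells Gamma) d <-> c = 0.
    split=> [/coh_boundP[b ->]|->]; last exact: rpred0.
    have -> : b = 0.
      by apply: coefP => F _ cF; exfalso; move: cF dq; lia.
    exact: (linearfun0 (@coboundary_linear _ _ _ _ _)).
  split=> [/cech_bound0P e|->]; last by apply/cech_bound0P; exact: cech_of0.
  rewrite -(@cech_ofK Gamma hG d 0 c) ?dq // e -(cech_of0 Gamma d 0).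
  by rewrite cech_ofK // dq.
have qd : q%:Z = d - 1 + 1 by rewrite subrK dq; lia.
have dE : d = d - 1 + 1 by rewrite subrK.
split=> [/cech_boundP[b bE]|/coh_boundP[b ->]].
  apply/coh_boundP; exists (chain_of (d - 1) b).
  rewrite -(chain_of_diff hG b qd dE) -bE cech_ofK //; lia.
apply/cech_boundP; exists (cech_of q b); exact: cech_of_coboundary.
Qed.

End CechCells.

(** [cech_of] carries cocycles onto homogeneous Cech cocycles and respects restriction and
    boundaries, so the rank is transported along it. *)
Lemma lcoh_rank_cells (k : fieldType) (n : nat) (alpha : 'I_n -> int) (i : 'I_n)
    (Gamma Gamma' : {set {set 'I_n}}) q r :
  simplicial_complex Gamma -> simplicial_complex Gamma' ->
  Gamma' \subset Gamma ->
  coh_rank k (cells alpha [set~ i] Gamma) (cells alpha [set~ i] Gamma')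
    (q%:Z - 1) r ->
  lcoh_rank k Gamma Gamma' i q alpha r.
Proof.
move=> hG hG' sub; have subK := cells_subfamily alpha [set~ i] hG' sub.
move=> /(coh_rankE _ _ _ subK); set d := q%:Z - 1 => hr.
have qd : q%:Z = d + 1 by rewrite subrK.
pose J := [set~ i].
pose g (z : cech (@var k n) J (SR k Gamma) q) :
    restr (cech_quot (@var k n) J (SR k Gamma') q) :=
  quotmod_pi (@cech_bound _ _ (@var k n) J (SR k Gamma') q)
    (cech_fun (@SR_map k n Gamma Gamma') z).
have SRlin := @SR_map_linear k n _ _ sub.
apply: (@eq_has_dim _ _ (image_of g
    (fun z => cech_diff q.+1 z = 0 /\ cech_deg alpha z))) => [w|].
  exact: iff_sym (lcoh_map_image SRlin _ _).
apply: (has_dim_transport_image (h := @cech_of k n alpha J Gamma d q) _ _ _ _ _ _ _ hr).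
- by move=> a b c; rewrite /= transfer_linear quotmod_pi_linear.
- move=> a b c; have e := cech_of_linear (alpha := alpha) (J := J) q a b c.
  exact: etrans (congr1 g e) (cech_fun_pi_linear SRlin a%:MP_[n] _ _).
- exact: (linearfun0 (@coboundary_linear _ _ _ _ _)).
- by move=> a z z' z0 z0'; rewrite coboundary_linear z0 z0' scaler0 addr0.
- move=> z z0; split; last exact: cech_of_deg.
  have := cech_of_coboundary (J := J) z qd (erefl _).
  rewrite z0 => <-; exact: cech_of0.
- move=> z [z0 degz]; exists (chain_of alpha d z); last exact/esym/chain_ofK.
  have := chain_of_diff alpha hG z qd (erefl _).
  rewrite z0 => <-; apply: chain_of0 => //; by rewrite -addn1 PoszD qd.
move=> z _; rewrite /g cech_of_transfer // !quotmod_pi_eq0.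
exact: iff_sym (cech_of_bound _ hG' (erefl _)).
Qed.

(** * Cells in terms of links, deletions and cones *)

Section Complexes.
Variable n : nat.
Implicit Types (Gamma : {set {set 'I_n}}) (sigma tau F : {set 'I_n}).

Lemma subcomplex_subfamily Gamma Gamma' :
  simplicial_complex Gamma' -> Gamma' \subset Gamma -> subfamily Gamma' Gamma.
Proof. by move=> hG' sub; split=> // tau j tG _; apply: hG' tG (subD1set _ _). Qed.

Lemma stage_complex (R : realType) Gamma (f : {set 'I_n} -> R) t :
  simplicial_complex Gamma -> monotonic Gamma f ->
  simplicial_complex (stage Gamma f t).
Proof.
move=> hG hf tau sigma; rewrite !inE => /andP[sG ft] ts.
have tG := hG _ _ sG ts.
by rewrite tG (le_trans (hf _ _ tG sG ts) ft).
Qed.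

Lemma stageS (R : realType) Gamma (f : {set 'I_n} -> R) s t :
  s <= t -> stage Gamma f s \subset stage Gamma f t.
Proof.
by move=> st; apply/subsetP => tau; rewrite !inE => /andP[-> /le_trans->].
Qed.

Lemma link_complex Gamma sigma :
  simplicial_complex Gamma -> simplicial_complex (link Gamma sigma).
Proof.
move=> hG tau rho; rewrite !inE => /andP[dis rG] tr.
by rewrite (disjointWl tr dis) (hG _ _ rG) // setSU.
Qed.

Lemma linkS Gamma Gamma' sigma :
  Gamma' \subset Gamma -> link Gamma' sigma \subset link Gamma sigma.
Proof.
move=> /subsetP sub; apply/subsetP => tau; rewrite !inE => /andP[-> /sub].
by [].
Qed.

Lemma deletion_complex Gamma i :
  simplicial_complex Gamma -> simplicial_complex (deletion Gamma i).
Proof.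
move=> hG tau rho; rewrite !inE => /andP[rG ir] tr.
by rewrite (hG _ _ rG tr) (contra (subsetP tr i) ir).
Qed.

Lemma deletionS Gamma Gamma' i :
  Gamma' \subset Gamma -> deletion Gamma' i \subset deletion Gamma i.
Proof. by move=> sub; rewrite /deletion !setIdE setSI. Qed.

Lemma simplicial_complexI Gamma Gamma' :
  simplicial_complex Gamma -> simplicial_complex Gamma' ->
  simplicial_complex (Gamma :&: Gamma').
Proof.
move=> hG hG' tau rho /setIP[rG rG'] tr.
by rewrite inE (hG _ _ rG tr) (hG' _ _ rG' tr).
Qed.

Lemma disjoints1U (v : 'I_n) tau sigma :
  [disjoint tau & v |: sigma] = (v \notin tau) && [disjoint tau & sigma].
Proof.
rewrite !disjoints_subset setCU subsetI.
by rewrite [_ \subset ~: [set v]]subsetC sub1set in_setC.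
Qed.

Variables (i : 'I_n) (alpha : 'I_n -> int).
Local Notation sigma := (supp_neg i alpha).
Local Notation cells := (cells alpha [set~ i]).

Lemma notin_supp_neg : i \notin sigma.
Proof. by rewrite inE eqxx. Qed.

Lemma negE : 0 <= alpha i -> neg alpha = sigma.
Proof.
move=> ai; apply/setP => j; rewrite !inE; case: eqP => [->|] //=.
by rewrite ltNge ai.
Qed.

Lemma posE : supp_pos i alpha = set0 ->
  pos alpha = if 0 < alpha i then [set i] else set0.
Proof.
move=> /setP s0; apply/setP => j; have := s0 j; rewrite !inE.
have [->|ji] /= := eqVneq j i; first by case: ifP; rewrite !inE ?eqxx.
by move=> ->; case: ifP; rewrite !inE ?(negPf ji).
Qed.

(** Here [pos] is empty, so the cells are the faces of [Gamma] that avoid [i] and contain sigma. *)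
Lemma shifted_link_deletion Gamma :
  simplicial_complex Gamma -> supp_pos i alpha = set0 -> alpha i = 0 ->
  shifted sigma (link Gamma sigma :&: deletion Gamma i) (cells Gamma).
Proof.
move=> hG /posE p0 ai; rewrite ai ltxx in p0.
have nE : neg alpha = sigma by rewrite negE // ai.
split=> [tau|F].
  move=> /setIP[]; rewrite [tau \in link _ _]inE [tau \in deletion _ _]inE.
  move=> /andP[dis tG] /andP[_ it].
  split=> //; apply/cellsP; rewrite p0 setU0 nE; split=> //; last exact: subsetUr.
  by rewrite subsetC sub1set in_setC in_setU negb_or it notin_supp_neg.
move=> /cellsP[]; rewrite p0 setU0 nE => FJ sF FG; split=> //.
have iF : i \notin F by move: FJ; rewrite subsetC sub1set inE.
have dis : [disjoint F :\: sigma & sigma] by have /subsetDP[] := subxx (F :\: sigma).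
apply/setIP; rewrite [_ \in link _ _]inE [_ \in deletion _ _]inE setDUK // dis FG.
by rewrite (hG _ _ FG (subsetDl _ _)) in_setD (negPf iF) andbF.
Qed.

(** Here [pos] is the singleton of [i], so a cell must stay a face after adding [i], which puts [i]
    into the link. *)
Lemma shifted_link Gamma :
  supp_pos i alpha = set0 -> 1 <= alpha i ->
  shifted sigma (link Gamma (i |: sigma)) (cells Gamma).
Proof.
move=> /posE p0 ai; have ai0 : 0 < alpha i by exact: lt_le_trans ai.
rewrite ai0 in p0; have nE : neg alpha = sigma by rewrite negE // ltW.
split=> [tau|F].
  rewrite [tau \in _]inE disjoints1U => /andP[/andP[it dis] tG].
  split=> //.
  apply/cellsP; rewrite p0 nE -setUA [sigma :|: _]setUC; split=> //.
    by rewrite subsetC sub1set in_setC in_setU negb_or it notin_supp_neg.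
  exact: subsetUr.
move=> /cellsP[]; rewrite p0 nE => FJ sF FG; split=> //.
have iF : i \notin F by move: FJ; rewrite subsetC sub1set inE.
rewrite [_ \in link _ _]inE disjoints1U in_setD (negPf iF) andbF /=.
rewrite [i |: sigma]setUC setUA setDUK // FG andbT.
by have /subsetDP[] := subxx (F :\: sigma).
Qed.

(** The vertex [v] is in [pos], so [F :|: pos] does not see whether [v] is in [F], and [v] is not in
    [neg]. *)
Lemma cells_cone Gamma v :
  simplicial_complex Gamma -> v \in supp_pos i alpha ->
  forall F, F \in cells Gamma -> F :\ v \in cells Gamma /\ v |: F \in cells Gamma.
Proof.
move=> hG; rewrite inE => /andP[vi av] F /cellsP[FJ nF FG].
split; apply/cellsP; split.
- exact: subset_trans (subD1set _ _) FJ.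
- by rewrite subsetD1 nF inE -leNgt ltW.
- by apply: hG FG _; rewrite setSU // subD1set.
- by rewrite subUset FJ andbT sub1set !inE.
- by apply: subset_trans nF _; exact: subsetUr.
- by rewrite -setUA setUCA (setUidPr (_ : [set v] \subset pos alpha)) // sub1set inE.
Qed.

End Complexes.

(** * Ranks for a pair of complexes and for the stages of a filtration *)

Section Rank.
Variables (k : fieldType) (n : nat) (i : 'I_n) (alpha : 'I_n -> int) (q : nat).
Variables Gamma Gamma' : {set {set 'I_n}}.
Hypotheses (hG : simplicial_complex Gamma) (hG' : simplicial_complex Gamma').
Hypothesis sub : Gamma' \subset Gamma.

Lemma lcoh_rank0 : supp_pos i alpha != set0 -> lcoh_rank k Gamma Gamma' i q alpha 0.
Proof.
move=> /set0Pn[v vp]; apply: lcoh_rank_cells => //.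
apply: (@coh_rank_cone _ _ _ _ v); first exact: cells_subfamily.
exact: cells_cone.
Qed.

Lemma lcoh_rank_shifted (L L' : {set {set 'I_n}}) :
  let sigma := supp_neg i alpha in
  let d : int := q%:Z - #|sigma|%:Z - 1 in
  simplicial_complex L' -> L' \subset L ->
  shifted sigma L (cells alpha [set~ i] Gamma) ->
  shifted sigma L' (cells alpha [set~ i] Gamma') ->
  exists r, [/\ lcoh_rank k Gamma Gamma' i q alpha r, coh_rank k L L' d r
              & hom_rank k L' L d r].
Proof.
move=> sigma d hL' subL LK LK'; have sL := subcomplex_subfamily hL' subL.
have [r [cr hr]] := coh_hom_rank k d sL; exists r; split=> //.
apply: lcoh_rank_cells => //.
apply: (coh_rank_shift LK LK') cr => //; first exact: cells_subfamily.
(* A cell with [q] elements has dimension [q - 1], and removing sigma lowers it to [d]. *)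
by rewrite /d addrAC subrK.
Qed.

End Rank.

Theorem theorem3p8 (k : fieldType) (R : realType) (n : nat)
    (Delta : {set {set 'I_n}}) (f : {set 'I_n} -> R)
    (hDelta : simplicial_complex Delta)
    (hvert : forall j : 'I_n, [set j] \in Delta)
    (hf : monotonic Delta f)
    (i : 'I_n) (q : nat) (s t : R) (hst : s <= t) (alpha : 'I_n -> int) :
  let Ds := stage Delta f s in
  let Dt := stage Delta f t in
  let sigma := supp_neg i alpha in
  let d : int := q%:Z - #|sigma|%:Z - 1 in
  (supp_pos i alpha != set0 -> lcoh_rank k Dt Ds i q alpha 0) /\
  (supp_pos i alpha = set0 ->
    (alpha i = 0 ->
      let Ls := link Ds sigma :&: deletion Ds i in
      let Lt := link Dt sigma :&: deletion Dt i in
      exists r : nat,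
        [/\ lcoh_rank k Dt Ds i q alpha r,
            coh_rank k Lt Ls d r
          & hom_rank k Ls Lt d r]) /\
    (1 <= alpha i ->
      let Ls := link Ds (i |: sigma) in
      let Lt := link Dt (i |: sigma) in
      exists r : nat,
        [/\ lcoh_rank k Dt Ds i q alpha r,
            coh_rank k Lt Ls d r
          & hom_rank k Ls Lt d r])).
Proof.
move=> Ds Dt sigma d.
have hs : simplicial_complex Ds := stage_complex hDelta hf.
have ht : simplicial_complex Dt := stage_complex hDelta hf.
have sub : Ds \subset Dt := stageS Delta f hst.
split=> [|s0]; first exact: lcoh_rank0.
split=> ai Ls Lt; apply: lcoh_rank_shifted => //.
- by apply: simplicial_complexI; [exact: link_complex|exact: deletion_complex].
- by apply: setISS; [exact: linkS|exact: deletionS].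
- exact: shifted_link_deletion.
- exact: shifted_link_deletion.
- exact: link_complex.
- exact: linkS.
- exact: shifted_link.
- exact: shifted_link.
Qed.
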